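(* Consider the spatial factor model $\mathbf{y}_t=\mathbf{D}(\boldsymbol\rho)\mathbf{W}\mathbf{y}_t+\mathbf{B}\mathbf{f}_t+\boldsymbol\varepsilon_t$, $t=1,\dots,T$, with latent $K$-dimensional factors $\mathbf{f}_t$, equivalently $\mathbf{y}_t=\boldsymbol\Lambda\mathbf{f}_t+\boldsymbol\xi_t$, and let $\widehat{\boldsymbol\Lambda}$ be the autocovariance-based eigenanalysis estimator of the loading matrix $\boldsymbol\Lambda$ (defined in the context). Assume: (1) $\{(\mathbf{y}_t,\mathbf{f}_t)\}$ is strictly stationary and $\alpha$-mixing with mixing coefficients satisfying $\sum_{k=1}^\infty\alpha_N(k)^{1-2/\gamma}<\infty$ for some $\gamma>2$, where $\alpha_N(k)=\sup_i\sup_{A\in\mathcal{F}_{-\infty}^i,\,B\in\mathcal{F}_{i+k}^\infty}|P(A\cap B)-P(A)P(B)|$ and $\mathcal{F}_i^j$ is the $\sigma$-field generated by $\{(\mathbf{y}_t,\mathbf{f}_t):i\le t\le j\}$. (2) $\mathbf{W}$ is known with zero main diagonal, $\mathbf{S}_N(\boldsymbol\rho):=\mathbf{I}_N-\mathbf{D}(\boldsymbol\rho)\mathbf{W}$ is invertible, and the row and column sums of $|\mathbf{W}|$ and $|\mathbf{S}_N(\boldsymbol\rho)^{-1}|$ (entrywise absolute values) are bounded uniformly in $N$. (3) $\{\boldsymbol\varepsilon_t\}$ is a white noise process with $\mathrm{Cov}(\mathbf{y}_{t-j},\boldsymbol\varepsilon_t)=\mathbf{0}$ for $j\ge1$ and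 $\mathrm{Cov}(\mathbf{f}_{t-k},\boldsymbol\varepsilon_t)=\mathbf{0}$ for $k\ge0$. (4) $\mathbf{B}$ is of full rank and $\frac1N\mathbf{B}'\mathbf{S}_N'(\boldsymbol\rho)^{-1}\mathbf{S}_N(\boldsymbol\rho)^{-1}\mathbf{B}=\mathbf{I}_K$. (5) $E|f_{j,t}|^{2\gamma}<C$ and $E|\varepsilon_{k,t}|^{2\gamma}<C$ for $1\le j\le K$, $1\le k\le N$, with $\gamma$ as in (1). (6) For $i=1,\dots,N$ and any $\lambda>0$, the matrix $\mathbf{X}_i'\mathbf{X}_i+\lambda\mathbf{I}_{K+1}$ has rank $K+1$. If $N=o(T)$, then there exists an invertible matrix $\mathbf{H}_{NT}\in\mathbb{R}^{K\times K}$ such that (as $N,T\to\infty$) \[\frac{1}{\sqrt N}\|\widehat{\boldsymbol\Lambda}-\boldsymbol\Lambda\mathbf{H}_{NT}'\|_F=O_p\Big(\frac{1}{\sqrt T}\Big).\]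
   Context: Setting: for each $N$, $\mathbf{y}_t$ is an $N$-dimensional zero-mean panel, $\mathbf{f}_t\in\mathbb{R}^K$ is a zero-mean factor process with $K$ a fixed known integer, $\mathbf{W}$ is an $N\times N$ spatial weight matrix with rows $\mathbf{w}_1',\dots,\mathbf{w}_N'$, $\mathbf{D}(\boldsymbol\rho)=\mathrm{diag}(\rho_1,\dots,\rho_N)$, $\mathbf{B}$ is the $N\times K$ loading matrix, $\boldsymbol\varepsilon_t=(\varepsilon_{1,t},\dots,\varepsilon_{N,t})'$. $C$ is a generic constant. Put $\boldsymbol\Lambda=(\mathbf{I}_N-\mathbf{D}(\boldsymbol\rho)\mathbf{W})^{-1}\mathbf{B}$ and $\boldsymbol\xi_t=(\mathbf{I}_N-\mathbf{D}(\boldsymbol\rho)\mathbf{W})^{-1}\boldsymbol\varepsilon_t$, so $\boldsymbol\Lambda'\boldsymbol\Lambda/N=\mathbf{I}_K$. With $\boldsymbol\Sigma_{yf}(k)=\mathrm{Cov}(\mathbf{y}_t,\mathbf{f}_{t-k})$, $\boldsymbol\Sigma_f(k)=\mathrm{Cov}(\mathbf{f}_t,\mathbf{f}_{t-k})$ (argument omitted when $k=0$), \[\mathbf{X}_i=\begin{pmatrix}\boldsymbol\Sigma_{yf}'\mathbf{w}_i&\boldsymbol\Sigma_f'\\ \boldsymbol\Sigma_{yf}'(1)\mathbf{w}_i&\boldsymbol\Sigma_f'(1)\end{pmatrix}.\] Eigenanalysis: let $k_0\ge1$ be a fixed integer, $\boldsymbol\Sigma_y(k)=\mathrm{Cov}(\mathbf{y}_t,\mathbf{y}_{t-k})$,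 $\mathbf{M}=\sum_{k=1}^{k_0}\boldsymbol\Sigma_y(k)\boldsymbol\Sigma_y'(k)$; it is understood that $\mathbf{M}$ has $K$ non-zero eigenvalues. Let $\widehat{\boldsymbol\Sigma}_y(k)=\frac1T\sum_{t=k+1}^T\mathbf{y}_t\mathbf{y}_{t-k}'$ and $\widehat{\mathbf{M}}=\sum_{k=1}^{k_0}\widehat{\boldsymbol\Sigma}_y(k)\widehat{\boldsymbol\Sigma}_y'(k)$. $\widehat{\boldsymbol\Lambda}$ is the $N\times K$ matrix whose columns are $\sqrt N$ times orthonormal eigenvectors of $\widehat{\mathbf{M}}$ corresponding to its $K$ largest eigenvalues. $\|\cdot\|_F$ is the Frobenius norm.
   Formalization: The K non-zero eigenvalues of M are required to be at least cN^2 with c>0 independent of N, and the mixing sum in (1) is required to be bounded uniformly in N; with mere non-vanishing and finiteness for each N the claimed rate can fail. *)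

(* Defs.v *)
From HB Require Import structures.
From mathcomp Require Import all_boot all_order all_algebra.
From mathcomp Require Import all_classical all_reals all_analysis.

Set Implicit Arguments.
Unset Strict Implicit.
Unset Printing Implicit Defensive.

Import Order.TTheory GRing.Theory Num.Theory.
Import numFieldNormedType.Exports.

Local Open Scope classical_set_scope.
Local Open Scope ring_scope.

(* The data of the model for one cross-sectional dimension [N]; no property is
   recorded here.  Time runs over [int], because the mixing coefficients refer
   to the infinite past and future of the process. *)
Record panel (R : realType) (K N : nat) := Panel {
  pdisp : measure_display;
  pOm : measurableType pdisp;
  pPr : probability pOm R;
  py : int -> 'I_N -> {RV pPr >-> R};
  pf : int -> 'I_K -> {RV pPr >-> R};
  peps : int -> 'I_N -> {RV pPr >-> R};
  pW : 'M[R]_N;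
  prho : 'rV[R]_N;
  pB : 'M[R]_(N, K)
}.

Section Generic.
Variable R : realType.

Definition rvec d (T : measurableType d) (P : probability T R) n
    (X : 'I_n -> {RV P >-> R}) (w : T) : 'cV[R]_n := \col_i X i w.

Definition rmx d (T : measurableType d) (P : probability T R) m n
    (X : 'I_m -> 'I_n -> {RV P >-> R}) (w : T) : 'M[R]_(m, n) :=
  \matrix_(i, j) X i j w.

(* [fine] loses nothing for square integrable variables. *)
Definition Covmx d (T : measurableType d) (P : probability T R) m n
    (X : 'I_m -> {RV P >-> R}) (Y : 'I_n -> {RV P >-> R}) : 'M[R]_(m, n) :=
  \matrix_(i, j) fine (covariance P (X i) (Y j)).

Definition white_noise d (T : measurableType d) (P : probability T R) n
    (e : int -> 'I_n -> {RV P >-> R}) : Prop :=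
  [/\ forall t i, ('E_P[e t i] = 0)%E,
      forall s t, s <> t -> Covmx (e s) (e t) = 0
    & exists Sigma : 'M[R]_n, forall t, Covmx (e t) (e t) = Sigma].

Definition frob m n (A : 'M[R]_(m, n)) : R :=
  Num.sqrt (\sum_i \sum_j A i j ^+ 2).

Definition abs_sums_le m n (A : 'M[R]_(m, n)) (C : R) : Prop :=
  (forall i, \sum_j `|A i j| <= C) /\ (forall j, \sum_i `|A i j| <= C).

(* [s] lists the eigenvalues of [A], repeated according to multiplicity. *)
Definition spectrum n (A : 'M[R]_n) (s : seq R) : Prop :=
  char_poly A = \prod_(a <- s) ('X - a%:P).

(* [A] has exactly [k] non-zero eigenvalues (with multiplicity), all of them
   at least [lo].  As [Lambda^T *m Lambda = N%:R%:M], the matrix [Mmx] below is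
   of order [N ^ 2]; asymptotically in [N], "non-zero" is meant at that order,
   i.e. with [lo = c * N ^ 2] for a fixed [c > 0]. *)
Definition nonzero_eigenvalues n (A : 'M[R]_n) (k : nat) (lo : R) : Prop :=
  exists s : k.-tuple R,
    spectrum A (s ++ nseq (n - k) 0) /\
    (forall a, a \in s -> a != 0 /\ lo <= a).

(* The columns of [U] are orthonormal eigenvectors of [A] for its [k] largest
   eigenvalues, in any order: [r] lists the remaining eigenvalues. *)
Definition top_eigenvectors n k (A : 'M[R]_n) (U : 'M[R]_(n, k)) : Prop :=
  U^T *m U = 1%:M /\
  exists (a : k.-tuple R) (r : seq R),
    [/\ spectrum A (a ++ r),
        forall x y, x \in a -> y \in r -> y <= x
      & forall j, A *m col j U = tnth a j *: col j U].

(* [X_n = O_p(a_n)], each [X_n] living on its own probability space. *)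
Definition bigO_p (d : nat -> measure_display)
    (T : forall n, measurableType (d n)) (P : forall n, probability (T n) R)
    (X : forall n, T n -> R) (a : nat -> R) : Prop :=
  forall e : R, 0 < e ->
    exists2 M : R, 0 < M &
      \forall n \near \oo, (P n [set w | (M * a n < `|X n w|)%R] <= e%:E)%E.

End Generic.

Section Model.
Variables (R : realType) (K N : nat) (m : panel R K N).

Definition zstate (t : int) (w : pOm m) : (N + K).-tuple R :=
  [tuple of [tuple py m t i w | i < N] ++ [tuple pf m t j w | j < K]].

Definition strictly_stationary : Prop :=
  forall (n : nat) (t : n.-tuple int) (h : int)
         (E : set (n.-tuple ((N + K).-tuple R))),
    measurable E ->
    pPr m [set w | E [tuple zstate (tnth t i + h) w | i < n]] =
    pPr m [set w | E [tuple zstate (tnth t i) w | i < n]].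

Definition sigma_field (I : set int) : set (set (pOm m)) :=
  <<s [set A | exists (t : int) (E : set ((N + K).-tuple R)),
         [/\ I t, measurable E & A = zstate t @^-1` E] ]>>.

Definition alpha (k : nat) : R :=
  sup [set x : R | exists (i : int) (A B : set (pOm m)),
    [/\ sigma_field [set t | t <= i] A,
        sigma_field [set t | i + k%:Z <= t] B
      & x = fine `|pPr m (A `&` B) - pPr m A * pPr m B|%E] ].

Definition SN : 'M[R]_N := 1%:M - diag_mx (prho m) *m pW m.

Definition model_equation : Prop :=
  forall (t : int) (w : pOm m),
    rvec (py m t) w =
      diag_mx (prho m) *m pW m *m rvec (py m t) w
      + pB m *m rvec (pf m t) w + rvec (peps m t) w.

Definition Lambda : 'M[R]_(N, K) := invmx SN *m pB m.

(* By stationarity the autocovariances do not depend on the date; they are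
   taken at date 0. *)
Definition Sigma_y (k : nat) : 'M[R]_N := Covmx (py m 0) (py m (- k%:Z)).
Definition Sigma_yf (k : nat) : 'M[R]_(N, K) := Covmx (py m 0) (pf m (- k%:Z)).
Definition Sigma_f (k : nat) : 'M[R]_K := Covmx (pf m 0) (pf m (- k%:Z)).

Definition Xmx (i : 'I_N) : 'M[R]_(K + K, 1 + K) :=
  let w := (row i (pW m))^T in
  block_mx ((Sigma_yf 0)^T *m w) (Sigma_f 0)^T
           ((Sigma_yf 1)^T *m w) (Sigma_f 1)^T.

Definition Mmx (k0 : nat) : 'M[R]_N :=
  \sum_(1 <= k < k0.+1) Sigma_y k *m (Sigma_y k)^T.

Definition Sigma_y_hat (T k : nat) (w : pOm m) : 'M[R]_N :=
  T%:R^-1 *: \sum_(k.+1 <= t < T.+1)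
    rvec (py m t%:Z) w *m (rvec (py m (t%:Z - k%:Z)) w)^T.

Definition Mmx_hat (k0 T : nat) (w : pOm m) : 'M[R]_N :=
  \sum_(1 <= k < k0.+1) Sigma_y_hat T k w *m (Sigma_y_hat T k w)^T.

Definition loading_estimate (k0 T : nat) (w : pOm m) (L : 'M[R]_(N, K)) : Prop :=
  exists2 U : 'M[R]_(N, K), top_eigenvectors (Mmx_hat k0 T w) U
                          & L = Num.sqrt N%:R *: U.

End Model.

(* Main.v *)
Require Import Defs.
From HB Require Import structures.
From mathcomp Require Import all_boot all_order all_algebra.
From mathcomp Require Import ring lra zify.
From mathcomp Require complex.
From mathcomp Require Import all_classical all_reals all_analysis.
From mathcomp Require Import measurable_realfun.

(* Idea. Write the panel as y_t = L x_t, with x_t the stacked factors and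
   innovations and L = (Lambda, S^-1). Since y_(t-k) is uncorrelated with
   eps_t, Sigma_y(k) = Lambda Cov(f_t, y_(t-k)), so M is supported on the column
   space of Lambda, where its eigenvalues are at least c N^2. Each sample
   autocovariance of two coordinates of x has mean square error O(1/T), by
   stationarity and Davydov's inequality; weighting the coordinates by the
   absolute entries of L, whose squared row sums add up to O(N), gives
   |Mhat - M|_F = O_p(N^2 / sqrt T). The optimality of the leading eigenvectors
   (Ky Fan) against the curvature c N^2 of M turns this into an angle of order
   1 / sqrt T between the two eigenspaces, and H' = Lambda' Lambdahat / N is
   invertible as soon as this angle is small. *)

Set Implicit Arguments.
Unset Strict Implicit.
Unset Printing Implicit Defensive.

Import Order.TTheory GRing.Theory Num.Theory.
Import numFieldNormedType.Exports.

Local Open Scope classical_set_scope.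
Local Open Scope ring_scope.

(** * Rayleigh quotients and the angle of leading eigenspaces *)

Section Rayleigh.
Import complex.
Local Open Scope complex_scope.
Local Open Scope sesquilinear_scope.

(** No gap is established between the leading eigenvalues of [Mmx_hat] and the others, so the
    comparison runs through traces: only the K x K core of [Mmx] needs a lower bound. The eigenvalue
    hypothesis, however, concerns an N x N characteristic polynomial; determinant identities carry
    it over to the core. The rows of [Lambda] are controlled only on average, by the normalisation.
    Plain submultiplicativity of the Frobenius norm would lose a factor N in the error of [Mmx_hat],
    the matrix of source errors having (K + N)^2 entries. The weighted sum of squared errors used
    instead is a nonnegative combination of quantities bounded in mean, so a single use of Markov's
    inequality suffices, and everything is deterministic on the event where that sum is small.
    Moments of order [2 * gam] of the coordinates give moments of order [gam] of their products,
    which is what the mixing exponent [1 - 2 / gam] calls for. *)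

Lemma rayleigh_le (R : rcfType) n (A : 'M[R]_n) (mu : R) (v : 'rV[R]_n) :
  A^T = A -> (forall x, root (char_poly A) x -> x <= mu) ->
  (v *m A *m v^T) 0 0 <= mu * (v *m v^T) 0 0.
Proof.
move=> symA roots_le.
(* Complexification: [A] becomes Hermitian, hence unitarily diagonalisable with real eigenvalues,
   and each of these is a root of the real characteristic polynomial. *)
pose c : {rmorphism R -> R[i]} := real_complex R.
have conj_c m p (B : 'M[R]_(m, p)) : (map_mx c B)^t* = map_mx c B^T.
  by apply/matrixP => i j; rewrite !mxE conj_Creal//; apply/complex_realP; exists (B j i).
have hermA : map_mx c A \is hermsymmx.
  by apply/is_hermitianmxP; rewrite expr0 scale1r conj_c symA.
set P := spectralmx (map_mx c A); set d := spectral_diag (map_mx c A).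
have uP : P \is unitarymx by exact: spectral_unitarymx.
have AE : map_mx c A = P^t* *m diag_mx d *m P.
  by rewrite -invmx_unitary//; apply/orthomx_spectralP/hermitian_normalmx.
have PP : P *m P^t* = 1%:M by apply/unitarymxP.
have d_le i : d 0 i <= c mu.
  have /mxOverP/(_ 0 i) dreal := hermitian_spectral_diag_real hermA.
  have : root (char_poly (map_mx c A)) (d 0 i).
    rewrite -eigenvalue_root_char; apply/eigenvalueP; exists (row i P).
      rewrite AE !mulmxA -row_mul PP row1 -rowE row_diag_mx -scalemxAl.
      by rewrite -rowE.
    apply/eqP => /(congr1 (fun B => B *m P^t*)); rewrite mul0mx -row_mul PP row1.
    by move/matrixP/(_ 0 i)/eqP; rewrite !mxE !eqxx oner_eq0.
  have /complex_realP[x ->] : d 0 i \is Num.real by [].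
  by rewrite -map_char_poly fmorph_root lecR => /roots_le.
suff : c ((v *m A *m v^T) 0 0) <= c (mu * (v *m v^T) 0 0) by rewrite lecR.
(* In the coordinates [w] on the eigenbasis both forms are diagonal, and they are compared term by
   term. *)
set w := map_mx c v *m P^t*.
have wE : w^t* = P *m map_mx c v^T by rewrite -conj_c /w trmx_mul map_mxM trmxCK.
have -> : c ((v *m A *m v^T) 0 0) = (w *m diag_mx d *m w^t*) 0 0.
  have -> : w *m diag_mx d *m w^t* = map_mx c (v *m A *m v^T).
    by rewrite wE /w !map_mxM AE !mulmxA.
  by rewrite [RHS]mxE.
have -> : c (mu * (v *m v^T) 0 0) = c mu * (w *m w^t*) 0 0.
  rewrite wE /w -!mulmxA [P^t* *m _]mulmxA -(invmx_unitary uP).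
  rewrite mulVmx ?unitarymx_unit// mul1mx -map_mxM rmorphM; congr (_ * _).
  by rewrite [RHS]mxE.
rewrite !mxE mulr_sumr; apply: ler_sum => i _.
rewrite mul_mx_diag !mxE mulrAC mulrC ler_wpM2r ?mul_conjC_ge0//.
Qed.

End Rayleigh.

(** * Determinant identities for characteristic polynomials *)

Lemma det_block_mx1 (R : comNzRingType) m n (P : 'M[R]_m) (Q : 'M[R]_(m, n))
    (V : 'M[R]_(n, m)) :
  \det (block_mx P Q V 1%:M) = \det (P - Q *m V).
Proof.
have E : block_mx P Q V 1%:M *m block_mx 1%:M 0 (- V) 1%:M =
    block_mx (P - Q *m V) Q 0 1%:M.
  rewrite mulmx_block !mulmx1 !mulmx0 !mul1mx !add0r mulmxN.
  by rewrite subrr.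
have := congr1 determinant E.
by rewrite det_mulmx det_lblock det_ublock !det1 !mulr1.
Qed.

(** Deflation: the eigenvalues that [A] has on the invariant range of [U] are replaced by zeros. By
    Schur complement the first factor is a block determinant, and multiplying by a block triangular
    matrix reduces it to the blocks ['X%:M - A] and ['X%:M]. *)
Lemma char_poly_deflation (R : comNzRingType) m n (A : 'M[R]_m) (U : 'M[R]_(m, n))
    (V : 'M[R]_(n, m)) (D : 'M[R]_n) :
  V *m U = 1%:M -> A *m U = U *m D ->
  char_poly (A - U *m D *m V) * char_poly D = char_poly A * 'X^n.
Proof.
move=> VU AU; rewrite /char_poly /char_poly_mx.
set pA := map_mx polyC A; set pU := map_mx polyC U; set pV := map_mx polyC V.
set pD := map_mx polyC D.
have pVU : pV *m pU = 1%:M by rewrite -map_mxM VU map_mx1.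
have pAU : pA *m pU = pU *m pD by rewrite -!map_mxM AU.
have -> : 'X%:M - map_mx polyC (A - U *m D *m V)
    = ('X%:M - pA) - (- (pU *m pD)) *m pV.
  by rewrite map_mxB !map_mxM mulNmx opprK opprB addrCA addrC.
rewrite -det_block_mx1.
have E : block_mx ('X%:M - pA) (- (pU *m pD)) pV 1%:M *m
    block_mx 1%:M (pU *m pD) 0 ('X%:M - pD) = block_mx ('X%:M - pA) 0 pV 'X%:M.
  rewrite mulmx_block !mulmx1 !mulmx0 !mul1mx !addr0; congr block_mx.
    rewrite mulmxBl mulmxBr !mulNmx !mulmxA pAU scalar_mxC.
    by rewrite -!mulmxA opprK addrACA subrr addNr addr0.
  by rewrite mulmxA pVU mul1mx addrC subrK.
have := congr1 determinant E.
by rewrite det_mulmx det_ublock det_lblock det1 mul1r det_scalar.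
Qed.

(** Sylvester's identity, from two evaluations of one block determinant. It links an N x N matrix to
    its K x K core. *)
Lemma char_poly_mulmxC (R : comNzRingType) m n (U : 'M[R]_(m, n)) (B : 'M[R]_(n, m)) :
  char_poly (U *m B) * 'X^n = 'X^m * char_poly (B *m U).
Proof.
rewrite /char_poly /char_poly_mx !map_mxM.
set pU := map_mx polyC U; set pB := map_mx polyC B.
have E : block_mx 'X%:M pU pB 1%:M *m block_mx 1%:M (- pU) 0 'X%:M =
    block_mx 'X%:M 0 pB ('X%:M - pB *m pU).
  rewrite mulmx_block !mulmx1 !mulmx0 !mul1mx !addr0; congr block_mx.
    by rewrite mulmxN scalar_mxC addNr.
  by rewrite mulmxN addrC.
have := congr1 determinant E.
by rewrite det_mulmx det_ublock det_lblock det1 mul1r !det_scalar det_block_mx1.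
Qed.

(** * Squared Frobenius norms, traces and quadratic forms *)

Section SquaredNorm.
Variable R : realFieldType.

Definition sqfrob m n (A : 'M[R]_(m, n)) : R := \sum_i \sum_j A i j ^+ 2.

Lemma sqfrob_ge0 m n (A : 'M[R]_(m, n)) : 0 <= sqfrob A.
Proof. by do 2!apply: sumr_ge0 => ? _; exact: sqr_ge0. Qed.

Lemma mxtrace_mul_tr m n (A B : 'M[R]_(m, n)) :
  \tr (A *m B^T) = \sum_i \sum_j A i j * B i j.
Proof.
by apply: eq_bigr => i _; rewrite mxE; apply: eq_bigr => j _; rewrite mxE.
Qed.

Lemma sqfrobE m n (A : 'M[R]_(m, n)) : sqfrob A = \tr (A *m A^T).
Proof.
rewrite mxtrace_mul_tr.
by apply: eq_bigr => i _; apply: eq_bigr => j _; rewrite expr2.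
Qed.

(** Lagrange's identity: the difference of the two sides is half of a weighted double sum of
    squares. *)
Lemma weighted_Cauchy_Schwarz (I : finType) (w a b : I -> R) :
  (forall i, 0 <= w i) ->
  (\sum_i w i * (a i * b i)) ^+ 2 <=
  (\sum_i w i * a i ^+ 2) * (\sum_i w i * b i ^+ 2).
Proof.
move=> w0; rewrite -subr_ge0.
have : 0 <= \sum_i \sum_j w i * w j * (a i * b j - a j * b i) ^+ 2.
  do 2!apply: sumr_ge0 => ? _.
  by apply: mulr_ge0; [exact: mulr_ge0 | exact: sqr_ge0].
have -> : \sum_i \sum_j w i * w j * (a i * b j - a j * b i) ^+ 2 =
  \sum_i \sum_j (w i * a i ^+ 2) * (w j * b j ^+ 2)
  + \sum_i \sum_j (w i * b i ^+ 2) * (w j * a j ^+ 2)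
  - 2 * \sum_i \sum_j (w i * (a i * b i)) * (w j * (a j * b j)).
  rewrite mulr_sumr -big_split -sumrB /=; apply: eq_bigr => i _.
  rewrite mulr_sumr -big_split -sumrB /=; apply: eq_bigr => j _; ring.
rewrite -!big_distrlr /=; lra.
Qed.

Lemma mxtrace_Cauchy_Schwarz m n (A B : 'M[R]_(m, n)) :
  \tr (A *m B^T) ^+ 2 <= sqfrob A * sqfrob B.
Proof.
rewrite mxtrace_mul_tr /sqfrob !pair_bigA /=.
have E (F : 'I_m * 'I_n -> R) : \sum_p 1 * F p = \sum_p F p.
  by apply: eq_bigr => p _; rewrite mul1r.
have := @weighted_Cauchy_Schwarz _ (fun=> 1) (fun p : 'I_m * 'I_n => A p.1 p.2)
  (fun p => B p.1 p.2) (fun=> ler01).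
by rewrite !E.
Qed.

Lemma mxtrace_form m n (Z : 'M[R]_(m, n)) (S : 'M[R]_n) :
  \tr (Z *m S *m Z^T) = \sum_i (row i Z *m S *m (row i Z)^T) 0 0.
Proof.
by apply: eq_bigr => i _; rewrite tr_row -row_mul !mxE; apply: eq_bigr => j _;
  rewrite !mxE.
Qed.

Lemma mxtrace_form_ge m n (Z : 'M[R]_(m, n)) (S S' : 'M[R]_n) :
  (forall v : 'rV[R]_n, (v *m S *m v^T) 0 0 <= (v *m S' *m v^T) 0 0) ->
  \tr (Z *m S *m Z^T) <= \tr (Z *m S' *m Z^T).
Proof. by move=> SS; rewrite !mxtrace_form; exact: ler_sum. Qed.

End SquaredNorm.

(** Pythagoras: [1%:M - Q *m Q^T] is the orthogonal projector onto the complement of the range of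
    [Q]. The angle bound uses it with [Q] and [U] in either role. *)
Lemma gram_complement (R : comNzRingType) m n k (Q : 'M[R]_(m, k)) (U : 'M[R]_(m, n)) :
  Q^T *m Q = 1%:M ->
  ((1%:M - Q *m Q^T) *m U)^T *m ((1%:M - Q *m Q^T) *m U) =
  U^T *m U - (Q^T *m U)^T *m (Q^T *m U).
Proof.
move=> QQ; set P := 1%:M - Q *m Q^T.
have symP : P^T = P by rewrite /P linearB /= trmx1 trmx_mul trmxK.
have QP : Q^T *m P = 0 by rewrite /P mulmxBr mulmx1 mulmxA QQ mul1mx subrr.
have PP : P *m P = P by rewrite {1}/P mulmxBl mul1mx -mulmxA QP mulmx0 subr0.
rewrite trmx_mul symP mulmxA -(mulmxA U^T) PP /P mulmxBr mulmxBl mulmx1.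
by rewrite trmx_mul trmxK !mulmxA.
Qed.

(** * Ky Fan's principle and the angle between eigenspaces *)

Section DavisKahan.
Variable R : rcfType.

Lemma rayleigh_ge n (A : 'M[R]_n) (lo : R) (v : 'rV[R]_n) :
  A^T = A -> (forall x, root (char_poly A) x -> lo <= x) ->
  lo * (v *m v^T) 0 0 <= (v *m A *m v^T) 0 0.
Proof.
move=> symA lo_le; rewrite -lerN2 -mulNr.
have -> : - (v *m A *m v^T) 0 0 = (v *m (- A) *m v^T) 0 0.
  by rewrite mulmxN mulNmx [RHS]mxE.
apply: rayleigh_le; first by rewrite linearN /= symA.
move=> x; rewrite -eigenvalue_root_char => /eigenvalueP[u uA u0].
rewrite lerNr; apply: lo_le; rewrite -eigenvalue_root_char.
by apply/eigenvalueP; exists u => //; rewrite scaleNr -uA mulmxN opprK.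
Qed.

(** By Sylvester's identity the compression has the spectrum of [A] together with [m - n] further
    zeros. The zeros listed after [s] are exactly these, so cancelling ['X^m] identifies
    [char_poly A] with the product over [s]. *)
Lemma root_char_poly_compression m n (Q : 'M[R]_(m, n)) (A : 'M[R]_n) (s : seq R) :
  (n <= m)%N -> Q^T *m Q = 1%:M ->
  char_poly (Q *m A *m Q^T) = \prod_(x <- s ++ nseq (m - n) 0) ('X - x%:P) ->
  forall x, root (char_poly A) x -> x \in s.
Proof.
move=> le_nm QQ specQ; have := char_poly_mulmxC (Q *m A) Q^T.
rewrite specQ mulmxA QQ mul1mx big_cat big_nseq /= subr0.
rewrite -Monoid.iteropE /= -/('X^_) -mulrA -exprD subnK//.
rewrite mulrC => /(mulfI _) <-; first by move=> x; rewrite root_prod_XsubC.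
by rewrite expf_eq0 polyX_eq0 andbF.
Qed.

Variables (n k : nat) (A : 'M[R]_n) (U : 'M[R]_(n, k)) (a : k.-tuple R).
Variable r : seq R.
Hypotheses (symA : A^T = A) (psdA : forall v : 'rV[R]_n, 0 <= (v *m A *m v^T) 0 0).
Hypotheses (UU : U^T *m U = 1%:M)
  (specA : char_poly A = \prod_(x <- a ++ r) ('X - x%:P))
  (ra : forall x y, x \in a -> y \in r -> y <= x)
  (AU : forall j, A *m col j U = tnth a j *: col j U).

Let D := diag_mx (\row_j tnth a j).

Let AUD : A *m U = U *m D.
Proof.
apply/matrixP => i j; rewrite mul_mx_diag !mxE.
have /matrixP/(_ i 0) := AU j; rewrite !mxE mulrC => <-.
by apply: eq_bigr => l _; rewrite !mxE.
Qed.

Let a_ge0 j : 0 <= tnth a j.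
Proof.
have := psdA (col j U)^T; rewrite trmxK -mulmxA AU -scalemxAr mxE.
have -> : ((col j U)^T *m col j U) 0 0 = 1.
  have /matrixP/(_ j j) := UU; rewrite !mxE eqxx => E; apply: etrans E.
  by apply: eq_bigr => l _; rewrite !mxE.
by rewrite mulr1.
Qed.

(** The smallest leading eigenvalue separates the two groups, and it is nonnegative because [A] is
    positive semidefinite. For [k = 0] there is none, and any nonnegative upper bound of [r]
    serves. *)
Let separator : exists2 mu : R, 0 <= mu &
  (forall j, mu <= tnth a j) /\ (forall y, y \in r -> y <= mu).
Proof.
case: k U a UU specA ra AU @D AUD a_ge0 => [|k'] U' a' _ _ ra' _ _ _ a0.
  exists (\sum_(y <- r) `|y|); first exact: sumr_ge0.
  split => [[]//|y yr]; rewrite (big_rem _ yr) /=.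
  by rewrite (le_trans (ler_norm y))// lerDl sumr_ge0.
pose j0 := [arg min_(j < ord0 | true) tnth a' j]%O.
exists (tnth a' j0) => //; split => [j|y yr]; last by apply: ra' => //; exact: mem_tnth.
by rewrite /j0; case: arg_minP => // j1 _; apply.
Qed.

Let G := A - U *m D *m U^T.

Let symG : G^T = G.
Proof. by rewrite /G linearB /= symA !trmx_mul trmxK tr_diag_mx mulmxA. Qed.

Let char_poly_D : char_poly D = \prod_(x <- a) ('X - x%:P).
Proof.
rewrite char_poly_trig ?diag_mx_is_trig// big_tuple.
by apply: eq_bigr => j _; rewrite !mxE eqxx mulr1n.
Qed.

Let GU : G *m U = 0.
Proof. by rewrite /G mulmxBl -(mulmxA (U *m D)) UU mulmx1 AUD subrr. Qed.

(** The deflated matrix [G] has eigenvalues [r] and zeros, all at most [mu], and it kills the range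
    of [U]; the Rayleigh bound can therefore be applied to the projection of [v] only. *)
Let residual_le mu : 0 <= mu -> (forall y, y \in r -> y <= mu) ->
  forall v : 'rV[R]_n, (v *m G *m v^T) 0 0 <= (v *m (mu *: (1%:M - U *m U^T)) *m v^T) 0 0.
Proof.
move=> mu0 r_mu v; set P := 1%:M - U *m U^T.
have symP : P^T = P by rewrite /P linearB /= trmx1 trmx_mul trmxK.
have UP : U^T *m P = 0 by rewrite /P mulmxBr mulmx1 mulmxA UU mul1mx subrr.
have PP : P *m P = P by rewrite {1}/P mulmxBl mul1mx -mulmxA UP mulmx0 subr0.
have GP : G *m P = G by rewrite /P mulmxBr mulmx1 mulmxA GU mul0mx subr0.
have PG : P *m G = G.
  by apply: trmx_inj; rewrite trmx_mul symP symG GP.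
have -> : v *m G *m v^T = (v *m P) *m G *m (v *m P)^T.
  by rewrite trmx_mul symP [RHS]mulmxA -2![in RHS](mulmxA v) PG GP.
have -> : (v *m (mu *: P) *m v^T) 0 0 = mu * ((v *m P) *m (v *m P)^T) 0 0.
  by rewrite trmx_mul symP mulmxA -(mulmxA v P) PP -scalemxAr -scalemxAl mxE.
apply: rayleigh_le => // x.
have := char_poly_deflation UU AUD.
(* Cancelling the factor [char_poly D] leaves the eigenvalues [r] and [k] zeros; the zeros are where
   [0 <= mu] enters. *)
rewrite specA big_cat /= char_poly_D [RHS]mulrAC mulrC -mulrA => /mulfI ->.
  rewrite rootM root_prod_XsubC => /orP[|/r_mu//].
  by rewrite /root hornerXn expf_eq0 => /andP[_ /eqP ->].
by apply/monic_neq0/monic_prod_XsubC.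
Qed.

(** In [A = U *m D *m U^T + G] the frame [Q] puts a mass p_j, the diagonal entry of [Z^T *m Z], at
    most 1, on the eigenvalue a_j. The missing mass 1 - p_j meets only [G], where it earns at most
    [mu], which is below a_j. *)
Lemma ky_fan (Q : 'M[R]_(n, k)) : Q^T *m Q = 1%:M ->
  \tr (Q^T *m A *m Q) <= \tr (U^T *m A *m U).
Proof.
move=> QQ; have [mu mu0 [mu_a r_mu]] := separator.
have -> : U^T *m A *m U = D by rewrite -mulmxA AUD mulmxA UU mul1mx.
set Z := Q^T *m U.
have -> : Q^T *m A *m Q = Z *m D *m Z^T + Q^T *m G *m Q.
  by rewrite /G mulmxBr mulmxBl /Z trmx_mul trmxK !mulmxA addrC subrK.
rewrite mxtraceD.
have tG : \tr (Q^T *m G *m Q) <= mu * (k%:R - \tr (Z *m Z^T)).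
  have := mxtrace_form_ge Q^T (residual_le mu0 r_mu); rewrite trmxK => /le_trans; apply.
  rewrite -scalemxAr -scalemxAl mxtraceZ mulmxBr mulmxBl mulmx1 QQ linearB /=.
  by rewrite mxtrace1 /Z trmx_mul trmxK !mulmxA.
have p_le1 j : (Z^T *m Z) j j <= 1.
  have : 0 <= (((1%:M - Q *m Q^T) *m U)^T *m ((1%:M - Q *m Q^T) *m U)) j j.
    by rewrite mxE; apply: sumr_ge0 => i _; rewrite mxE -expr2 sqr_ge0.
  rewrite gram_complement// UU => p_ge0; move: p_ge0.
  by rewrite /Z trmx_mul trmxK mulmxA -(mulmxA _ Q) !mxE eqxx subr_ge0.
have -> : \tr (Z *m D *m Z^T) = \sum_j tnth a j * (Z^T *m Z) j j.
  rewrite -mulmxA mxtrace_mulC -mulmxA; apply: eq_bigr => j _.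
  by rewrite mul_diag_mx !mxE.
have trD : \tr D = \sum_j tnth a j.
  by apply: eq_bigr => j _; rewrite !mxE eqxx mulr1n.
move: tG; rewrite (mxtrace_mulC Z) trD.
set g := \tr _.
have -> : mu * (k%:R - \tr (Z^T *m Z)) = \sum_j mu * (1 - (Z^T *m Z) j j).
  by rewrite -mulr_sumr sumrB sumr_const card_ord.
move=> g_le; rewrite (le_trans (lerD (lexx _) g_le))// -big_split /=.
apply: ler_sum => j _; have := p_le1 j; have := mu_a j; nra.
Qed.

(* The curvature [lo] of [V |-> tr (V^T M V)] at its maximiser [Q] turns the
   optimality of [U] for [A] into a bound on the angle. *)
Lemma davis_kahan (Q : 'M[R]_(n, k)) (S : 'M[R]_k) (lo : R) :
  Q^T *m Q = 1%:M -> 0 <= lo ->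
  (forall v : 'rV[R]_k, lo * (v *m v^T) 0 0 <= (v *m S *m v^T) 0 0) ->
  lo ^+ 2 * sqfrob (U - Q *m (Q^T *m U)) <= 2 * sqfrob (A - Q *m S *m Q^T).
Proof.
move=> QQ lo0 Slo; set M := Q *m S *m Q^T; set s := sqfrob (U - _).
set Z := Q^T *m U; set tau := \tr (Z *m Z^T).
have sE : s = k%:R - tau.
  have -> : s = sqfrob ((1%:M - Q *m Q^T) *m U) by rewrite mulmxBl mul1mx -mulmxA.
  rewrite sqfrobE mxtrace_mulC gram_complement// UU linearB /= mxtrace1.
  by rewrite (mxtrace_mulC _ Z).
(* The part of [Q] outside the range of [U] also has squared norm [s], and the trace lost in passing
   from [S] to [Z^T *m S *m Z] is the form of [S] on the rows of [X]; the curvature makes it at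
   least [lo * s]. *)
pose X := (1%:M - U *m U^T) *m Q.
have XX : X^T *m X = 1%:M - Z *m Z^T.
  by rewrite /X gram_complement// QQ /Z !trmx_mul !trmxK.
have curv : lo * s <= \tr S - \tr (Z^T *m S *m Z).
  have -> : lo * s = \tr (X *m lo%:M *m X^T).
    rewrite mul_mx_scalar -scalemxAl mxtraceZ mxtrace_mulC XX linearB /= mxtrace1.
    by rewrite sE.
  have -> : \tr S - \tr (Z^T *m S *m Z) = \tr (X *m S *m X^T).
    rewrite [RHS]mxtrace_mulC (mulmxA X^T X S) XX mulmxBl mul1mx linearB /=; congr (_ - _).
    by rewrite -[in RHS]mulmxA [RHS]mxtrace_mulC.
  apply: mxtrace_form_ge => v.
  by rewrite mul_mx_scalar -scalemxAl mxE.
have trB (B1 B2 : 'M[R]_n) : \tr (B1 - B2) = \tr B1 - \tr B2 by exact: raddfB.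
have symP : (U *m U^T - Q *m Q^T)^T = U *m U^T - Q *m Q^T.
  by rewrite linearB /= !trmx_mul !trmxK.
(* The loss for [M] is charged to [A - M], because by Ky Fan the trace of [A] against
   [U *m U^T - Q *m Q^T] is nonnegative. *)
have gap : \tr S - \tr (Z^T *m S *m Z) <=
    \tr ((A - M) *m (U *m U^T - Q *m Q^T)^T).
  have form (V : 'M[R]_(n, k)) B : \tr (B *m (V *m V^T)) = \tr (V^T *m B *m V).
    by rewrite mulmxA mxtrace_mulC mulmxA.
  rewrite symP mulmxBr trB !mulmxBl !trB !form.
  have := ky_fan QQ.
  have -> : Q^T *m M *m Q = S.
    by rewrite /M !mulmxA QQ mul1mx -mulmxA QQ mulmx1.
  have -> : U^T *m M *m U = Z^T *m S *m Z.
    by rewrite /M /Z trmx_mul trmxK !mulmxA.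
  lra.
have CS := mxtrace_Cauchy_Schwarz (A - M) (U *m U^T - Q *m Q^T).
have dist : sqfrob (U *m U^T - Q *m Q^T) = 2 * s.
  rewrite sqfrobE symP mulmxBr !mulmxBl !trB.
  have idem (V : 'M[R]_(n, k)) : V^T *m V = 1%:M ->
      \tr (V *m V^T *m (V *m V^T)) = k%:R.
    by move=> VV; rewrite mulmxA -(mulmxA V) VV mulmx1 mxtrace_mulC VV mxtrace1.
  rewrite !idem// sE (mxtrace_mulC (U *m _)).
  have -> : \tr (Q *m Q^T *m (U *m U^T)) = tau.
    by rewrite -mulmxA mxtrace_mulC /tau /Z trmx_mul trmxK !mulmxA.
  ring.
have s0 : 0 <= s by exact: sqfrob_ge0.
set t := \tr ((A - M) *m _) in gap CS.
have lt : lo * s <= t by exact: le_trans curv gap.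
(* Squaring [lo * s <= t] and applying Cauchy-Schwarz leaves a factor [s] on both sides to divide
   out, so [s = 0] is settled apart. *)
have [->|spos] := eqVneq s 0; first by rewrite mulr0 mulr_ge0 ?sqfrob_ge0.
have H : (lo * s) ^+ 2 <= sqfrob (A - M) * (2 * s).
  rewrite -dist (le_trans _ CS)// ler_sqr ?nnegrE//; first exact: mulr_ge0.
  by rewrite (le_trans _ lt)// mulr_ge0.
have {}spos : 0 < s by rewrite lt_def spos.
rewrite -(ler_pM2r spos) (_ : _ * s = (lo * s) ^+ 2); last by ring.
by rewrite (_ : 2 * _ * s = sqfrob (A - M) * (2 * s)); last by ring.
Qed.

End DavisKahan.

(** * Frobenius bounds *)

Section FrobeniusBounds.
Variable R : realFieldType.

Lemma sqfrobZ m n (x : R) (A : 'M[R]_(m, n)) : sqfrob (x *: A) = x ^+ 2 * sqfrob A.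
Proof.
rewrite mulr_sumr; apply: eq_bigr => i _; rewrite mulr_sumr.
by apply: eq_bigr => j _; rewrite mxE exprMn.
Qed.

Lemma sqfrob_tr m n (A : 'M[R]_(m, n)) : sqfrob A^T = sqfrob A.
Proof.
rewrite /sqfrob exchange_big; apply: eq_bigr => i _; apply: eq_bigr => j _.
by rewrite mxE.
Qed.

Lemma sqfrob_mulmx m n p (A : 'M[R]_(m, n)) (B : 'M[R]_(n, p)) :
  sqfrob (A *m B) <= sqfrob A * sqfrob B.
Proof.
rewrite -(sqfrob_tr B) /sqfrob big_distrlr /=; apply: ler_sum => i _.
apply: ler_sum => j _; rewrite mxE.
have := @weighted_Cauchy_Schwarz _ _ (fun=> 1) (fun k => A i k) (fun k => B k j)
  (fun=> ler01).
have E (F : 'I_n -> R) : \sum_k 1 * F k = \sum_k F k.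
  by apply: eq_bigr => k _; rewrite mul1r.
rewrite !E => /le_trans; apply; rewrite ler_wpM2l ?sumr_ge0// => [k _|].
  exact: sqr_ge0.
by apply: ler_sum => k _; rewrite mxE.
Qed.

Lemma sqfrob_sum m n (I : finType) (X : I -> 'M[R]_(m, n)) :
  sqfrob (\sum_k X k) <= #|I|%:R * \sum_k sqfrob (X k).
Proof.
have -> : \sum_k sqfrob (X k) = \sum_i \sum_j \sum_k X k i j ^+ 2.
  rewrite exchange_big; apply: eq_bigr => i _; exact: exchange_big.
rewrite mulr_sumr; apply: ler_sum => i _; rewrite mulr_sumr.
apply: ler_sum => j _; rewrite summxE.
have := @weighted_Cauchy_Schwarz _ _ (fun=> 1) (fun=> 1) (fun k => X k i j)
  (fun=> ler01).
rewrite expr1n mulr1 sumr_const -[1 *+ _]/(#|I|%:R).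
by under eq_bigr do rewrite !mul1r;
  under [X in _ <= _ * X -> _]eq_bigr do rewrite mul1r.
Qed.

Lemma sqfrob3 m n (X Y Z : 'M[R]_(m, n)) :
  sqfrob (X + Y + Z) <= 3 * (sqfrob X + sqfrob Y + sqfrob Z).
Proof.
rewrite /sqfrob -!big_split /= mulr_sumr; apply: ler_sum => i _.
rewrite -!big_split /= mulr_sumr; apply: ler_sum => j _; rewrite !mxE.
move: (X i j) (Y i j) (Z i j) => x y z.
have := sqr_ge0 (x - y); have := sqr_ge0 (y - z); have := sqr_ge0 (x - z); nra.
Qed.

Definition row_abs_sum m n (L : 'M[R]_(m, n)) (i : 'I_m) : R := \sum_a `|L i a|.

(** Column [a] is charged with the absolute row sums of the rows that use it. The total is the sum
    of the squared row sums, which in the model is of order N even if single rows are large. *)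
Definition source_weight m n (L : 'M[R]_(m, n)) (a : 'I_n) : R :=
  \sum_i row_abs_sum L i * `|L i a|.

Lemma row_abs_sum_ge0 m n (L : 'M[R]_(m, n)) i : 0 <= row_abs_sum L i.
Proof. exact: sumr_ge0. Qed.

Lemma source_weight_ge0 m n (L : 'M[R]_(m, n)) a : 0 <= source_weight L a.
Proof.
by apply: sumr_ge0 => i _; rewrite mulr_ge0 ?row_abs_sum_ge0.
Qed.

Lemma sum_source_weight m n (L : 'M[R]_(m, n)) :
  \sum_a source_weight L a = \sum_i row_abs_sum L i ^+ 2.
Proof.
by rewrite exchange_big; apply: eq_bigr => i _; rewrite -mulr_sumr expr2.
Qed.

(** Cauchy-Schwarz in each entry [(i, j)], with weights |L i a| |L j b| of total mass
    [row_abs_sum L i * row_abs_sum L j]. The bound [sqfrob L ^+ 2 * sqfrob G] would in the model be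
    larger by a factor of order N^2. *)
Lemma sqfrob_sandwich m n (L : 'M[R]_(m, n)) (G : 'M[R]_n) :
  sqfrob (L *m G *m L^T) <=
  \sum_a \sum_b source_weight L a * source_weight L b * G a b ^+ 2.
Proof.
pose w i j (p : 'I_n * 'I_n) := `|L i p.1| * `|L j p.2|.
have entry i j : (L *m G *m L^T) i j ^+ 2 <=
    (row_abs_sum L i * row_abs_sum L j) * \sum_p w i j p * G p.1 p.2 ^+ 2.
  (* The signs of the entries of [L] move into the second factor to keep the weights nonnegative;
     their squares are at most 1. *)
  have -> : (L *m G *m L^T) i j =
      \sum_p w i j p * (Num.sg (L i p.1) * Num.sg (L j p.2) * G p.1 p.2).
    rewrite -(pair_bigA _ (fun a b => w i j (a, b) *
      (Num.sg (L i a) * Num.sg (L j b) * G a b))) /= exchange_big mxE.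
    apply: eq_bigr => b _; rewrite !mxE mulr_suml; apply: eq_bigr => a _.
    by rewrite /w /= [in LHS](numEsg (L i a)) [in LHS](numEsg (L j b)); ring.
  apply: (le_trans (weighted_Cauchy_Schwarz _ _ _)).
    by move=> p; rewrite mulr_ge0.
  rewrite ler_wpM2r ?sumr_ge0// => [p _|].
    by rewrite mulr_ge0 ?sqr_ge0// mulr_ge0.
  rewrite big_distrlr /= pair_bigA /=; apply: ler_sum => p _.
  rewrite -[leRHS]mulr1 ler_wpM2l ?mulr_ge0// exprMn !sqr_sg.
  by do 2!case: (_ != 0); rewrite ?mulr0 ?mul0r ?mulr1 ?ler01.
apply: (@le_trans _ _ (\sum_i \sum_j
    (row_abs_sum L i * row_abs_sum L j) * \sum_p w i j p * G p.1 p.2 ^+ 2)).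
  by apply: ler_sum => i _; apply: ler_sum => j _; exact: entry.
rewrite le_eqVlt; apply/orP; left; apply/eqP.
rewrite [RHS]pair_bigA /=.
under eq_bigr => i _ do under eq_bigr => j _ do rewrite mulr_sumr.
under eq_bigr => i _ do rewrite exchange_big /=.
rewrite exchange_big /=; apply: eq_bigr => p _.
rewrite /source_weight big_distrlr /= mulr_suml; apply: eq_bigr => i _.
by rewrite mulr_suml; apply: eq_bigr => j _; rewrite /w; ring.
Qed.

(** The factor block [A] is controlled in Frobenius norm only, whence Cauchy-Schwarz over its [k]
    columns; the innovation block [B] has uniformly bounded absolute row sums. *)
Lemma sum_sqr_row_abs_sum_row_mx m k n (A : 'M[R]_(m, k)) (B : 'M[R]_(m, n)) (C : R) :
  (forall i, \sum_j `|B i j| <= C) ->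
  \sum_i row_abs_sum (row_mx A B) i ^+ 2 <=
  2 * k%:R * sqfrob A + 2 * m%:R * C ^+ 2.
Proof.
move=> BC.
have -> : 2 * k%:R * sqfrob A + 2 * m%:R * C ^+ 2 =
    \sum_i (2 * k%:R * \sum_j A i j ^+ 2 + 2 * C ^+ 2).
  by rewrite big_split /= -mulr_sumr sumr_const card_ord -mulr_natl; congr (_ + _); ring.
apply: ler_sum => i _; rewrite /row_abs_sum big_split_ord /=.
under eq_bigr do rewrite row_mxEl.
under [X in (_ + X) ^+ 2]eq_bigr do rewrite row_mxEr.
set x := \sum_(_ < k) _; set y := \sum_(_ < n) _.
have y0 : 0 <= y by exact: sumr_ge0.
have yC : y ^+ 2 <= C ^+ 2.
  by rewrite lerXn2r ?nnegrE ?BC// (le_trans y0)// BC.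
have xA : x ^+ 2 <= k%:R * \sum_j A i j ^+ 2.
  have := @weighted_Cauchy_Schwarz _ _ (fun=> 1) (fun=> 1) (fun j => `|A i j|)
    (fun=> ler01).
  rewrite expr1n mulr1 sumr_const card_ord -[1 *+ _]/(k%:R).
  under eq_bigr do rewrite !mul1r.
  by under [X in _ <= _ * X -> _]eq_bigr do rewrite mul1r real_normK ?num_real//.
rewrite -mulrA; move: xA yC; move: (k%:R * _) (C ^+ 2) => u v.
have := sqr_ge0 (x - y); nra.
Qed.

(** The difference of Gram matrices is a sum of three terms, one quadratic in [E k]. The a priori
    bound [u] absorbs one factor of that term, so the estimate stays linear in the errors and a
    first moment will control it. *)
Lemma gram_perturbation n p (I : finType) (S E : I -> 'M[R]_(n, p)) (s : I -> R)
    (V u : R) :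
  (forall k, sqfrob (E k) <= s k) -> (forall k, sqfrob (S k) <= V) ->
  (forall k, s k <= u) ->
  sqfrob (\sum_k (S k + E k) *m (S k + E k)^T - \sum_k S k *m (S k)^T) <=
  #|I|%:R * (3 * (u + 2 * V)) * \sum_k s k.
Proof.
move=> Es SV su; rewrite -sumrB; apply: (le_trans (sqfrob_sum _)).
rewrite -mulrA ler_wpM2l// mulr_sumr; apply: ler_sum => k _.
have -> : (S k + E k) *m (S k + E k)^T - S k *m (S k)^T =
    E k *m (E k)^T + E k *m (S k)^T + S k *m (E k)^T.
  rewrite linearD /= mulmxDl !mulmxDr.
  rewrite [LHS]addrC !addrA addNr add0r addrC -[RHS]addrA; congr (_ + _); exact: addrC.
have E0 := sqfrob_ge0 (E k); have S0 := sqfrob_ge0 (S k).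
have e1 := sqfrob_mulmx (E k) (E k)^T; have e2 := sqfrob_mulmx (E k) (S k)^T.
have e3 := sqfrob_mulmx (S k) (E k)^T; rewrite !sqfrob_tr in e1 e2 e3.
apply: (le_trans (sqfrob3 _ _ _)); rewrite -mulrA ler_wpM2l//.
have Ek := Es k; have Sk := SV k; have uk := su k.
have EE := ler_pM E0 E0 (le_trans Ek uk) Ek.
have ES := ler_pM E0 S0 Ek Sk.
rewrite (mulrC (sqfrob (S k))) in e3.
have h1 := le_trans e1 EE; have h2 := le_trans e2 ES; have h3 := le_trans e3 ES.
have -> : (u + 2 * V) * s k = u * s k + s k * V + s k * V by ring.
exact: lerD (lerD h1 h2) h3.
Qed.

End FrobeniusBounds.

(** * Real-valued expectations and the covariance inequality *)

Section RealExpectation.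
Context d (T : measurableType d) (R : realType) (P : probability T R).
Implicit Types f g : T -> R.

Definition integ f := P.-integrable setT (EFin \o f).
(** A divergent integral is read as 0, which is why most rules below carry [integ]. *)
Definition Ex f : R := \int[P]_w f w.

Lemma integ_measurable f : integ f -> measurable_fun setT f.
Proof. by move=> /measurable_int/measurable_EFinP. Qed.

Lemma integ_dominated f g :
  measurable_fun setT f -> integ g -> (forall w, `|f w| <= g w) -> integ f.
Proof.
move=> mf ig fg; apply: le_integrable ig => //; first exact/measurable_EFinP.
move=> w _ /=; rewrite lee_fin (le_trans (fg w))//; exact: ler_norm.
Qed.

Lemma integ_cst (c : R) : integ (fun=> c).
Proof. exact: finite_measure_integrable_cst. Qed.

Lemma integ_bounded f (c : R) :
  measurable_fun setT f -> (forall w, `|f w| <= c) -> integ f.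
Proof. by move=> mf fc; exact: integ_dominated (integ_cst c) fc. Qed.

Lemma integD f g : integ f -> integ g -> integ (fun w => f w + g w).
Proof. by move=> mf mg; have := integrableD measurableT mf mg. Qed.

Lemma integB f g : integ f -> integ g -> integ (fun w => f w - g w).
Proof. by move=> mf mg; have := integrableB measurableT mf mg. Qed.

Lemma integZ (c : R) f : integ f -> integ (fun w => c * f w).
Proof. by move=> mf; have := integrableZl measurableT c mf. Qed.

Lemma integ_sum I (s : seq I) (F : I -> T -> R) :
  (forall i, integ (F i)) -> integ (fun w => \sum_(i <- s) F i w).
Proof.
move=> iF; elim: s => [|i s IH].
  by under [X in integ X]funext do rewrite big_nil; exact: integ_cst.
by under [X in integ X]funext do rewrite big_cons; exact: integD.
Qed.

Lemma ExD f g : integ f -> integ g -> Ex (fun w => f w + g w) = Ex f + Ex g.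
Proof. by move=> mf mg; exact: RintegralD. Qed.

Lemma ExB f g : integ f -> integ g -> Ex (fun w => f w - g w) = Ex f - Ex g.
Proof. by move=> mf mg; exact: RintegralB. Qed.

Lemma ExZ (c : R) f : integ f -> Ex (fun w => c * f w) = c * Ex f.
Proof. by move=> mf; exact: RintegralZl. Qed.

Lemma Ex_cst (c : R) : Ex (fun=> c) = c.
Proof.
transitivity (c * fine (P setT)); first exact: Rintegral_cst.
by rewrite probability_setT mulr1.
Qed.

Lemma Ex_sum I (s : seq I) (F : I -> T -> R) : (forall i, integ (F i)) ->
  Ex (fun w => \sum_(i <- s) F i w) = \sum_(i <- s) Ex (F i).
Proof.
move=> iF; elim: s => [|i s IH].
  by under [X in Ex X]funext do rewrite big_nil; rewrite Ex_cst big_nil.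
under [X in Ex X]funext do rewrite big_cons.
by rewrite ExD// ?IH ?big_cons//; exact: integ_sum.
Qed.

Lemma Ex_le f g : integ f -> integ g -> (forall w, f w <= g w) -> Ex f <= Ex g.
Proof. by move=> mf mg fg; exact: le_Rintegral. Qed.

Lemma Ex_ge0 f : (forall w, 0 <= f w) -> 0 <= Ex f.
Proof. by move=> f0; exact: Rintegral_ge0. Qed.

Lemma Ex_norm f : integ f -> `|Ex f| <= Ex (fun w => `|f w|).
Proof. by move=> mf; exact: le_normr_Rintegral. Qed.

Lemma integ_norm f : integ f -> integ (fun w => `|f w|).
Proof. by move=> mf; exact: integrable_norm. Qed.

Lemma Ex_norm_le f g : measurable_fun setT f -> integ g ->
  (forall w, `|f w| <= g w) -> `|Ex f| <= Ex g.
Proof.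
move=> mf ig fg; have jf := integ_dominated mf ig fg.
by rewrite (le_trans (Ex_norm jf))//; apply: Ex_le => //; exact: integ_norm.
Qed.

Lemma Ex_indic (A : set T) : measurable A -> Ex \1_A = fine (P A).
Proof. by move=> mA; rewrite /Ex /Rintegral integral_indic// setIT. Qed.

Lemma integ_indic (A : set T) : measurable A -> integ \1_A.
Proof.
move=> mA; apply: (@integ_bounded _ 1); first exact: measurable_indic.
by move=> w; rewrite indicE; case: (w \in A); rewrite ?normr1 ?normr0.
Qed.

Lemma integ_of_expectation f (c : \bar R) : measurable_fun setT f ->
  (forall w, 0 <= f w) -> ('E_P[f] < c)%E -> integ f.
Proof.
move=> mf f0; rewrite unlock => lt; apply/integrableP; split.
  exact/measurable_EFinP.
rewrite (eq_integral (fun w => (f w)%:E)); last first.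
  by move=> w _ /=; rewrite ger0_norm.
by rewrite (lt_le_trans lt)// leey.
Qed.

Lemma Markov_Ex f (c : R) : integ f -> (forall w, 0 <= f w) -> 0 < c ->
  fine (P [set w | c <= f w]) <= Ex f / c.
Proof.
move=> jf f0 c0; have mf := integ_measurable jf.
have mA : measurable [set w | c <= f w].
  have -> : [set w | c <= f w] = setT `&` f @^-1` `[c, +oo[%classic.
    by apply/seteqP; split => w /=; rewrite in_itv/= andbT => // -[].
  exact: mf.
rewrite -Ex_indic// ler_pdivlMr// mulrC -ExZ; last exact: integ_indic.
apply: Ex_le => //; first exact/integZ/integ_indic.
move=> w; rewrite indicE; case: (boolP (w \in _)); last by rewrite mulr0.
by rewrite inE /= mulr1.
Qed.

(** A bound on the alpha-mixing coefficient between the sigma-fields generated by [X] and [Y], whose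
    events are these preimages. *)
Definition mixing_le (X Y : T -> R) (al : R) := forall A B : set R,
  measurable A -> measurable B ->
  `|fine (P (X @^-1` A `&` Y @^-1` B)) - fine (P (X @^-1` A)) * fine (P (Y @^-1` B))|
    <= al.

End RealExpectation.

(** On [0, 1] this rounds [x] down to a multiple of 1/(n+1). It is written as an average of
    indicators of upper level sets, so that the covariance of two quantized variables is a double
    average of covariances of events: a discrete form of Hoeffding's covariance formula. *)
Definition quantize (R : realType) (n : nat) (x : R) : R :=
  n.+1%:R^-1 * \sum_(j < n.+1) (j.+1%:R <= n.+1%:R * x)%R%:R.

Lemma quantize_bounds (R : realType) n (x : R) : 0 <= x <= 1 ->
  0 <= quantize n x /\ 0 <= x - quantize n x <= n.+1%:R^-1.
Proof.
move=> /andP[x0 x1]; set y := n.+1%:R * x.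
have y0 : 0 <= y by rewrite mulr_ge0.
have n0 : 0 < n.+1%:R :> R by [].
have cnt N m : (\sum_(j < N) (j < m) = minn m N)%N.
  elim: N => [|N IH]; first by rewrite big_ord0 minn0.
  by rewrite big_ord_recr /= IH; lia.
have qE : quantize n x = n.+1%:R^-1 * (Num.truncn y)%:R.
  congr (_ * _); rewrite -/y.
  rewrite (eq_bigr (fun j : 'I_n.+1 => ((j < Num.truncn y)%N : nat)%:R)).
    rewrite -natr_sum cnt; congr (_%:R); apply/minn_idPl.
    rewrite -(ler_nat R) (@le_trans _ _ y) ?truncn_le//.
    by rewrite /y ler_piMr.
  by move=> j _; rewrite truncn_gt_nat.
have /andP[t_le t_gt] := truncn_itv y0.
have xE : x = n.+1%:R^-1 * y by rewrite mulKf// gt_eqF.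
split; first by rewrite qE mulr_ge0// invr_ge0 ltW.
rewrite qE {1 2}xE -mulrBr; have i0 : 0 <= n.+1%:R^-1 :> R by rewrite invr_ge0.
rewrite -natr1 in t_gt; apply/andP; split.
  by apply: mulr_ge0 => //; lra.
by rewrite ler_piMr//; lra.
Qed.

Section CovarianceInequality.
Context d (T : measurableType d) (R : realType) (P : probability T R).
Local Notation Ex := (@Ex _ T R P).
Local Notation integ := (@integ _ T R P).

Lemma fine_prob_le1 (A : set T) : measurable A -> 0 <= fine (P A) <= 1.
Proof.
move=> mA; rewrite fine_ge0//= -lee_fin fineK ?fin_num_measure//.
exact: probability_le1.
Qed.

Lemma quantizeE (n : nat) (X : T -> R) w :
  quantize n (X w) = n.+1%:R^-1 *
   \sum_(j < n.+1) \1_(X @^-1` `[j.+1%:R / n.+1%:R, +oo[) w.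
Proof.
congr (_ * _); apply: eq_bigr => j _; rewrite indicE.
suff -> : (w \in X @^-1` `[j.+1%:R / n.+1%:R, +oo[) = (j.+1%:R <= n.+1%:R * X w) by [].
by apply/idP/idP; rewrite inE/= in_itv/= andbT ler_pdivrMr// mulrC.
Qed.

Lemma unit_covariance_le (X Y : T -> R) (al : R) :
  measurable_fun setT X -> measurable_fun setT Y ->
  (forall w, 0 <= X w <= 1) -> (forall w, 0 <= Y w <= 1) ->
  mixing_le P X Y al ->
  `|Ex (fun w => X w * Y w) - Ex X * Ex Y| <= al.
Proof.
move=> mX mY X01 Y01 XYal.
have ib (Z : T -> R) : measurable_fun setT Z -> (forall w, 0 <= Z w <= 1) -> integ Z.
  move=> mZ Z01; apply: (@integ_bounded _ _ _ _ _ 1) => // w.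
  by have /andP[z0 z1] := Z01 w; rewrite ger0_norm.
(* Quantization changes [Ex (fun w => X w * Y w)] and [Ex X * Ex Y] by amounts in [0, 2/(n+1)] that
   enter with opposite signs; then n tends to infinity. *)
suff H n : `|Ex (fun w => X w * Y w) - Ex X * Ex Y| <= al + 2 * n.+1%:R^-1.
  apply/ler_addgt0Pr => e e0.
  have [n nP] : exists n, 2 * n.+1%:R^-1 <= e.
    exists (Num.truncn (2 / e)); rewrite ler_pdivrMr// -ler_pdivrMl// mulrC ltW//.
    exact: truncnS_gt.
  by rewrite (le_trans (H n))// lerD2l.
set N : R := n.+1%:R.
have N0 : 0 < N by [].
pose A (Z : T -> R) (j : 'I_n.+1) := Z @^-1` `[j.+1%:R / N, +oo[%classic.
have mA Z j : measurable_fun setT Z -> measurable (A Z j).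
  by move=> mZ; rewrite -[A Z j]setTI; exact: mZ.
pose q (Z : T -> R) := fun w => quantize n (Z w).
have qE Z : q Z = fun w => N^-1 * \sum_(j < n.+1) \1_(A Z j) w.
  by apply/funext => w; exact: quantizeE.
have i1 Z j : measurable_fun setT Z -> integ \1_(A Z j).
  by move=> mZ; apply/integ_indic/mA.
have iq Z : measurable_fun setT Z -> integ (q Z).
  by move=> mZ; rewrite qE; apply/integZ/integ_sum => j; exact: i1.
have mq Z : measurable_fun setT Z -> measurable_fun setT (q Z).
  by move=> /iq/integ_measurable.
have qP Z w : (forall w, 0 <= Z w <= 1) -> 0 <= q Z w /\ 0 <= Z w - q Z w <= N^-1.
  by move=> Z01; exact: quantize_bounds.
have Eq Z : measurable_fun setT Z -> Ex (q Z) = N^-1 * \sum_(j < n.+1) fine (P (A Z j)).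
  move=> mZ; rewrite qE ExZ; last by apply/integ_sum => j; exact: i1.
  rewrite Ex_sum; last by move=> j; exact: i1.
  by congr (_ * _); apply: eq_bigr => j _; rewrite Ex_indic//; exact: mA.
have qq01 w : 0 <= q X w * q Y w <= 1.
  have [x0 /andP[xl _]] := qP X w X01; have [y0 /andP[yl _]] := qP Y w Y01.
  have := X01 w; have := Y01 w.
  by nra.
have mqq : measurable_fun setT (fun w => q X w * q Y w).
  by apply: measurable_funM; exact: mq.
have Eqq : Ex (fun w => q X w * q Y w) =
    N^-1 * (N^-1 * \sum_(j < n.+1) \sum_(l < n.+1) fine (P (A X j `&` A Y l))).
  have iqq j l : integ \1_(A X j `&` A Y l).
    by apply/integ_indic/measurableI; exact: mA.
  transitivity (Ex (fun w => N^-1 * (N^-1 *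
      \sum_(j < n.+1) \sum_(l < n.+1) \1_(A X j `&` A Y l) w))).
    congr (Ex _); apply/funext => w; rewrite !qE mulrACA -mulrA; congr (_ * (_ * _)).
    rewrite big_distrlr /=; apply: eq_bigr => j _; apply: eq_bigr => l _.
    by rewrite indicI.
  have is1 : integ (fun w => \sum_(j < n.+1) \sum_(l < n.+1) \1_(A X j `&` A Y l) w).
    by apply/integ_sum => j; exact/integ_sum.
  rewrite !ExZ//; last exact: integZ.
  rewrite Ex_sum; last by move=> j; exact: integ_sum.
  congr (_ * (_ * _)); apply: eq_bigr => j _; rewrite Ex_sum//.
  by apply: eq_bigr => l _; rewrite Ex_indic//; apply: measurableI; exact: mA.
have covq : `|Ex (fun w => q X w * q Y w) - Ex (q X) * Ex (q Y)| <= al.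
  rewrite Eqq !Eq// mulrACA -mulrA -!mulrBr big_distrlr /= -sumrB.
  rewrite !normrM gtr0_norm ?invr_gt0//.
  rewrite !ler_pdivrMl//.
  apply: le_trans (ler_norm_sum _ _ _) _.
  rewrite (_ : N * (N * al) = \sum_(j < n.+1) \sum_(l < n.+1) al); last first.
    by rewrite !sumr_const card_ord -mulrnA -[RHS]mulr_natl natrM mulrA.
  apply: ler_sum => j _; rewrite -sumrB; apply: le_trans (ler_norm_sum _ _ _) _.
  by apply: ler_sum => l _; exact: XYal.
have iX := ib _ mX X01; have iY := ib _ mY Y01.
have iXY : integ (fun w => X w * Y w).
  apply: ib; first exact: measurable_funM.
  by move=> w; have := X01 w; have := Y01 w; nra.
have iqqq := ib _ mqq qq01.
have d1 : 0 <= Ex (fun w => X w * Y w) - Ex (fun w => q X w * q Y w) <= 2 * N^-1.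
  rewrite -ExB//; apply/andP; split.
    apply: Ex_ge0 => w.
    have [x0 /andP[xl _]] := qP X w X01; have [y0 /andP[yl _]] := qP Y w Y01; nra.
  rewrite -[leRHS](@Ex_cst _ _ _ P); apply: Ex_le; [exact: integB|exact: integ_cst|] => w.
  have [x0 /andP[xl xu]] := qP X w X01; have [y0 /andP[yl yu]] := qP Y w Y01.
  have := X01 w; have := Y01 w; move: xl xu yl yu; move: (N^-1) => u; nra.
have dE (Z : T -> R) : measurable_fun setT Z -> (forall w, 0 <= Z w <= 1) ->
    [/\ 0 <= Ex (q Z), 0 <= Ex Z - Ex (q Z) <= N^-1 & Ex Z <= 1].
  move=> mZ Z01; have iZ := ib _ mZ Z01; have jZ := iq _ mZ; split.
  - by apply: Ex_ge0 => w; have [] := qP Z w Z01.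
  - rewrite -ExB//; apply/andP; split.
      by apply: Ex_ge0 => w; have [_ /andP[]] := qP Z w Z01.
    rewrite -[leRHS](@Ex_cst _ _ _ P); apply: Ex_le; [exact: integB|exact: integ_cst|] => w.
    by have [_ /andP[]] := qP Z w Z01.
  - rewrite -[leRHS](@Ex_cst _ _ _ P); apply: Ex_le => //; first exact: integ_cst.
    by move=> w; have /andP[] := Z01 w.
have [a0 /andP[a1 a2] a3] := dE _ mX X01; have [b0 /andP[b1 b2] b3] := dE _ mY Y01.
have d2 : 0 <= Ex X * Ex Y - Ex (q X) * Ex (q Y) <= 2 * N^-1.
  move: a0 a1 a2 a3 b0 b1 b2 b3; move: (N^-1) (Ex (q X)) (Ex (q Y)) (Ex X) (Ex Y).
  move=> u p r x y p0 pl pu x1 q0 ql qu y1.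
  have -> : x * y - p * r = x * (y - r) + r * (x - p) by ring.
  have x0 : 0 <= x by lra.
  have h1 : 0 <= x * (y - r) <= u.
    by rewrite mulr_ge0//= (le_trans _ qu)// ler_piMl.
  have h2 : 0 <= r * (x - p) <= u.
    by rewrite mulr_ge0//= (le_trans _ pu)// ler_piMl//; lra.
  lra.
move: covq d1 d2; rewrite !ler_norml -/N.
move: (Ex (fun w => q X w * q Y w)) (Ex (fun w => X w * Y w)) (Ex X * _) (Ex _ * _).
by move: (N^-1) => u a1' b1' c1 e1; lra.
Qed.

End CovarianceInequality.

(** * Davydov's inequality under moments of order [gam] *)

Section PowerBounds.
Variables (R : realType) (gam : R).
Hypothesis hgam : 2 < gam.

(** Above the level [a] the power [gam] dominates the square with the gain a^(2 - gam); the
    truncation errors below all rest on this. *)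
Lemma sqr_le_powR (a x : R) : 0 < a -> a <= `|x| ->
  `|x| ^+ 2 <= a `^ (2 - gam) * `|x| `^ gam.
Proof.
move=> a0 ax; have x0 : 0 < `|x| by exact: lt_le_trans ax.
have -> : `|x| `^ gam = `|x| ^+ 2 * `|x| `^ (gam - 2).
  rewrite -powR_mulrn ?ltW// -powRD ?(gt_eqF x0) ?implybT//.
  by congr (_ `^ _); ring.
rewrite mulrCA ler_peMr ?sqr_ge0//.
have -> : 2 - gam = - (gam - 2) by ring.
rewrite powRN -ler_pdivrMl ?invr_gt0 ?powR_gt0// invrK mulr1.
by apply: ge0_ler_powR => //; [rewrite subr_ge0 ltW | rewrite nnegrE ltW].
Qed.

Lemma sqr_le_1powR (x : R) : x ^+ 2 <= 1 + `|x| `^ gam.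
Proof.
have p0 := powR_ge0 `|x| gam; rewrite -normr_id in p0 *.
have [x1|x1] := leP `|x| 1.
  rewrite -(real_normK (num_real x)) (@le_trans _ _ 1)// ?lerDl ?powR_ge0//.
  by rewrite exprn_ile1.
have := sqr_le_powR ltr01 (ltW x1); rewrite powR1 mul1r real_normK ?num_real//.
by move=> /le_trans; apply; rewrite normr_id lerDr.
Qed.

Lemma norm_le_1powR (x : R) : `|x| <= 1 + `|x| `^ gam.
Proof.
have p0 := powR_ge0 `|x| gam.
have [x1|x1] := leP `|x| 1; first by rewrite (le_trans x1)// lerDl.
have := sqr_le_1powR x; rewrite -(real_normK (num_real x)); nra.
Qed.

(** The larger of |x| and |y| is at least [a], and the product is at most its square. *)
Lemma mul_le_powR (a x y : R) : 0 < a -> a <= `|x| ->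
  `|x| * `|y| <= a `^ (2 - gam) * (`|x| `^ gam + `|y| `^ gam).
Proof.
move=> a0 ax; have [p0 q0] := (powR_ge0 `|x| gam, powR_ge0 `|y| gam).
have k0 := powR_ge0 a (2 - gam); rewrite mulrDr.
have := normr_ge0 x; have := normr_ge0 y; have := sqr_le_powR a0 ax.
have [yx|yx] := leP `|y| `|x|.
  have := mulr_ge0 k0 q0; nra.
have := sqr_le_powR a0 (le_trans ax (ltW yx)); have := mulr_ge0 k0 p0; nra.
Qed.

Lemma powR_mul_le (x y : R) :
  `|x * y| `^ gam <= `|x| `^ (2 * gam) + `|y| `^ (2 * gam).
Proof.
have g0 : 0 <= gam by have := hgam; lra.
rewrite !powRrM !powR_mulrn// normrM.
wlog yx : x y / `|y| <= `|x|.
  by move=> H; have [/H//|/ltW/H] := leP `|y| `|x|; rewrite mulrC addrC.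
apply: (@le_trans _ _ ((`|x| ^+ 2) `^ gam)); last by rewrite lerDl powR_ge0.
by apply: ge0_ler_powR; rewrite ?nnegrE ?mulr_ge0 ?sqr_ge0// expr2 ler_wpM2l.
Qed.

Lemma norm_mul_le_2powR (x y : R) :
  `|x * y| <= 2 + (`|x| `^ gam + `|y| `^ gam).
Proof.
have := sqr_le_1powR x; have := sqr_le_1powR y; rewrite normrM.
rewrite -(real_normK (num_real x)) -(real_normK (num_real y)); nra.
Qed.

End PowerBounds.

Section Davydov.
Context d (T : measurableType d) (R : realType) (P : probability T R).
Local Notation Ex := (@Ex _ T R P).
Local Notation integ := (@integ _ T R P).
Local Notation mixing_le := (@mixing_le _ T R P).

Lemma mixing_le_comp (X Y : T -> R) (g h : R -> R) al :
  measurable_fun setT g -> measurable_fun setT h ->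
  mixing_le X Y al -> mixing_le (g \o X) (h \o Y) al.
Proof.
move=> mg mh XY A B mA mB; apply: (XY (g @^-1` A) (h @^-1` B));
  rewrite -[X in measurable X]setTI; [exact: mg|exact: mh].
Qed.

(** An affine map sends [-a, a] to [0, 1] and divides covariances by [(2 * a) ^+ 2]. *)
Lemma bounded_covariance_le (X Y : T -> R) (a al : R) :
  measurable_fun setT X -> measurable_fun setT Y -> 0 < a ->
  (forall w, `|X w| <= a) -> (forall w, `|Y w| <= a) ->
  mixing_le X Y al ->
  `|Ex (fun w => X w * Y w) - Ex X * Ex Y| <= 4 * a ^+ 2 * al.
Proof.
move=> mX mY a0 Xa Ya XY.
pose g (x : R) := (2 * a)^-1 * (x + a).
have mg : measurable_fun setT g by apply: measurable_funM => //; exact: measurable_funD.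
have g01 (Z : T -> R) : (forall w, `|Z w| <= a) -> forall w, 0 <= g (Z w) <= 1.
  move=> Za w; have := Za w; rewrite ler_norml /g => /andP[z1 z2].
  by rewrite mulr_ge0 ?invr_ge0/= ?ler_pdivrMl ?mulr1; lra.
have mgZ (Z : T -> R) : measurable_fun setT Z -> measurable_fun setT (g \o Z).
  by move=> mZ; exact: measurableT_comp.
have ig (Z : T -> R) : measurable_fun setT Z -> (forall w, `|Z w| <= a) ->
    integ (g \o Z).
  move=> mZ Za; apply: (@integ_bounded _ _ _ _ _ 1); first exact: mgZ.
  by move=> w /=; have /andP[z0 z1] := g01 _ Za w; rewrite ger0_norm.
have ZE (Z : T -> R) : Z = fun w => 2 * a * (g \o Z) w - a.
  by apply/funext => w; rewrite /= mulrA mulfV ?mul1r ?addrK// mulf_neq0// gt_eqF.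
have EZ (Z : T -> R) : measurable_fun setT Z -> (forall w, `|Z w| <= a) ->
    Ex Z = 2 * a * Ex (g \o Z) - a.
  move=> mZ Za; rewrite {1}(ZE Z) ExB; [|exact/integZ/ig|exact: integ_cst].
  by rewrite ExZ ?Ex_cst//; exact: ig.
have := unit_covariance_le (mgZ _ mX) (mgZ _ mY) (g01 _ Xa) (g01 _ Ya)
  (mixing_le_comp mg mg XY).
have [iX iY] := (ig _ mX Xa, ig _ mY Ya).
have iXY : integ (fun w => (g \o X) w * (g \o Y) w).
  apply: (@integ_bounded _ _ _ _ _ 1).
    by apply: measurable_funM; exact: mgZ.
  move=> w; have /andP[x0 x1] := g01 _ Xa w; have /andP[y0 y1] := g01 _ Ya w.
  by rewrite ger0_norm; [exact: mulr_ile1|exact: mulr_ge0].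
have -> : Ex (fun w => X w * Y w) = 4 * a ^+ 2 * Ex (fun w => (g \o X) w * (g \o Y) w)
    - 2 * a ^+ 2 * Ex (g \o X) - 2 * a ^+ 2 * Ex (g \o Y) + a ^+ 2.
  transitivity (Ex (fun w => 4 * a ^+ 2 * ((g \o X) w * (g \o Y) w)
    - 2 * a ^+ 2 * (g \o X) w - 2 * a ^+ 2 * (g \o Y) w + a ^+ 2)).
    congr (Ex _); apply/funext => w; rewrite {1}(ZE X) {1}(ZE Y); ring.
  rewrite ExD; [|by apply/integB; [apply/integB|]; exact: integZ|exact: integ_cst].
  rewrite !ExB; [|exact: integZ|exact: integZ|by apply/integB; exact: integZ|exact: integZ].
  by rewrite Ex_cst (ExZ _ iXY) (ExZ _ iX) (ExZ _ iY).
rewrite (EZ _ mX Xa) (EZ _ mY Ya).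
set u := Ex (fun w => _); set v := Ex _; set z := Ex _ => H.
have -> : 4 * a ^+ 2 * u - 2 * a ^+ 2 * v - 2 * a ^+ 2 * z + a ^+ 2 -
  (2 * a * v - a) * (2 * a * z - a) = 4 * a ^+ 2 * (u - v * z) by ring.
have c0 : 0 <= 4 * a ^+ 2 by rewrite mulr_ge0 ?sqr_ge0.
by rewrite normrM (ger0_norm c0) ler_wpM2l.
Qed.

(** Large values are set to 0 rather than capped: the truncation error is the variable itself above
    the level and vanishes below it. *)
Definition clip (a x : R) := if `|x| <= a then x else 0.

Lemma clip_le a x : 0 <= a -> `|clip a x| <= a.
Proof. by rewrite /clip; case: ifP => // _; rewrite normr0. Qed.

Lemma clip_le_norm a x : `|clip a x| <= `|x|.
Proof. by rewrite /clip; case: ifP => // _; rewrite normr0. Qed.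

Lemma measurable_clip a : measurable_fun setT (clip a).
Proof.
apply: measurable_fun_ifT => //.
by apply: measurable_fun_ler => //.
Qed.

Variables (gam D : R).
Hypotheses (hgam : 2 < gam).

(** The first term is the bound for the clipped variables. In units of a^(2 - gam), truncation costs
    [4 * D] in the mean of the product and [2 * D * (1 + D)] in the product of the means, [1 + D]
    bounding each mean. *)
Lemma davydov_level (X Y : T -> R) (al a : R) :
  measurable_fun setT X -> measurable_fun setT Y ->
  integ (fun w => `|X w| `^ gam) -> integ (fun w => `|Y w| `^ gam) ->
  Ex (fun w => `|X w| `^ gam) <= D -> Ex (fun w => `|Y w| `^ gam) <= D ->
  mixing_le X Y al -> 1 <= a ->
  `|Ex (fun w => X w * Y w) - Ex X * Ex Y| <=
    4 * a ^+ 2 * al + (4 * D + 2 * D * (1 + D)) * a `^ (2 - gam).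
Proof.
move=> mX mY pX pY XD YD XY a1; have a0 : 0 < a by lra.
set kap := a `^ (2 - gam); have kap0 : 0 <= kap by exact: powR_ge0.
have D0 : 0 <= D by apply: le_trans XD; apply: Ex_ge0 => w; exact: powR_ge0.
pose X1 := clip a \o X; pose Y1 := clip a \o Y.
have m1 (Z : T -> R) : measurable_fun setT Z -> measurable_fun setT (clip a \o Z).
  by move=> mZ; apply: measurableT_comp => //; exact: measurable_clip.
have b1 (Z : T -> R) w : `|(clip a \o Z) w| <= a by apply: clip_le; exact: ltW.
have := bounded_covariance_le (m1 _ mX) (m1 _ mY) a0 (b1 X) (b1 Y)
  (mixing_le_comp (measurable_clip a) (measurable_clip a) XY).
rewrite -/X1 -/Y1.
have iZ (Z : T -> R) : measurable_fun setT Z -> integ (fun w => `|Z w| `^ gam) ->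
    integ Z /\ integ (clip a \o Z).
  move=> mZ pZ; have i1 := integD (integ_cst P 1) pZ.
  split; first by apply: integ_dominated i1 _ => // w; exact: norm_le_1powR.
  apply: integ_dominated i1 _ => [|w]; first exact: m1.
  by rewrite (le_trans (clip_le_norm _ _))// norm_le_1powR.
have EZ (Z : T -> R) : measurable_fun setT Z -> integ (fun w => `|Z w| `^ gam) ->
    Ex (fun w => `|Z w| `^ gam) <= D ->
    [/\ `|Ex Z| <= 1 + D, `|Ex (clip a \o Z)| <= 1 + D &
     `|Ex Z - Ex (clip a \o Z)| <= kap * D].
  move=> mZ pZ ZD; have [jZ jZ1] := iZ _ mZ pZ.
  have i1 := integD (integ_cst P 1) pZ.
  have e1 : Ex (fun w => 1 + `|Z w| `^ gam) <= 1 + D.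
    by rewrite ExD ?Ex_cst ?lerD2l//; exact: integ_cst.
  split.
  - apply: le_trans e1; apply: Ex_norm_le => // w; exact: norm_le_1powR.
  - apply: le_trans e1; apply: Ex_norm_le => // [|w]; first exact: m1.
    by rewrite (le_trans (clip_le_norm _ _))// norm_le_1powR.
  - rewrite -ExB// (@le_trans _ _ (Ex (fun w => kap * `|Z w| `^ gam)))//.
      apply: Ex_norm_le => [||w]; [|exact: integZ|].
        by apply: measurable_funB => //; exact: m1.
      rewrite /= /clip; case: (leP `|Z w| a) => Za.
        by rewrite subrr normr0 mulr_ge0// powR_ge0.
      (* Here [1 <= a] is used: above the level it gives |Z w| <= |Z w|^2. *)
      rewrite subr0 (le_trans _ (sqr_le_powR hgam a0 (ltW Za)))//; nra.
    by rewrite ExZ// ler_wpM2l.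
have [[iX iX1] [iY iY1]] := (iZ _ mX pX, iZ _ mY pY).
have [EX EX1 dX] := EZ _ mX pX XD; have [EY EY1 dY] := EZ _ mY pY YD.
have ipp : integ (fun w => kap * (`|X w| `^ gam + `|Y w| `^ gam)).
  by apply: integZ; exact: integD.
have iXY : integ (fun w => X w * Y w).
  have ip2 := integD (integ_cst P 2) (integD pX pY).
  apply: integ_dominated ip2 _ => [|w]; first exact: measurable_funM.
  exact: norm_mul_le_2powR.
have iXY1 : integ (fun w => X1 w * Y1 w).
  apply: (@integ_bounded _ _ _ _ _ (a * a)).
    by apply: measurable_funM; exact: m1.
  by move=> w; rewrite normrM ler_pM// b1.
have dXY : `|Ex (fun w => X w * Y w) - Ex (fun w => X1 w * Y1 w)| <= 4 * D * kap.
  rewrite -ExB// (@le_trans _ _ (Ex (fun w => 2 *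
      (kap * (`|X w| `^ gam + `|Y w| `^ gam)))))//.
    apply: Ex_norm_le => [||w]; [|exact: integZ|].
      by apply: measurable_funB => //; apply: measurable_funM => //; exact: m1.
    have -> : X w * Y w - X1 w * Y1 w = (X w - X1 w) * Y w + X1 w * (Y w - Y1 w).
      by ring.
    have far (x y : R) : `|x - clip a x| * `|y| <= kap * (`|x| `^ gam + `|y| `^ gam).
      rewrite /clip; case: (leP `|x| a) => xa.
        by rewrite subrr normr0 mul0r mulr_ge0// addr_ge0 ?powR_ge0.
      by rewrite subr0 mul_le_powR// ltW.
    rewrite (le_trans (ler_normD _ _))// !normrM.
    have f1 := far (X w) (Y w); have f2 := far (Y w) (X w).
    have f3 : `|X1 w| * `|Y w - Y1 w| <= `|Y w - Y1 w| * `|X w|.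
      by rewrite mulrC ler_wpM2l//; exact: clip_le_norm.
    rewrite mulr_natl mulr2n lerD// (le_trans f3)// (le_trans f2)//.
    by rewrite addrC.
  rewrite ExZ// ExZ; last exact: integD.
  by rewrite ExD//; nra.
move: EX EX1 dX EY EY1 dY dXY.
move: (Ex (fun w => X1 w * Y1 w)) (Ex (fun w => X w * Y w)) => v u.
rewrite -/X1 -/Y1; move: (Ex X1) (Ex Y1) (Ex X) (Ex Y) => x1 y1 x y.
move=> EX EX1 dX EY EY1 dY dXY H.
have -> : u - x * y = (u - v) + (v - x1 * y1) - ((x - x1) * y + x1 * (y - y1)) by ring.
have e1 : `|(x - x1) * y| <= kap * D * (1 + D) by rewrite normrM ler_pM.
have e2 : `|x1 * (y - y1)| <= (1 + D) * (kap * D) by rewrite normrM ler_pM.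
move: e1 e2 dXY H; rewrite !ler_norml; lra.
Qed.

(** The level a = al^(-1/gam) balances a^2 al against a^(2 - gam): both equal al^(1 - 2/gam), and
    [al <= 1] ensures [1 <= a]. *)
Lemma davydov (X Y : T -> R) (al : R) :
  measurable_fun setT X -> measurable_fun setT Y ->
  integ (fun w => `|X w| `^ gam) -> integ (fun w => `|Y w| `^ gam) ->
  Ex (fun w => `|X w| `^ gam) <= D -> Ex (fun w => `|Y w| `^ gam) <= D ->
  mixing_le X Y al -> al <= 1 ->
  `|Ex (fun w => X w * Y w) - Ex X * Ex Y| <=
    (4 + 4 * D + 2 * D * (1 + D)) * al `^ (1 - 2 / gam).
Proof.
move=> mX mY pX pY XD YD XY al1; have hg := hgam.
have lev a := davydov_level mX mY pX pY XD YD XY (a := a).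
set c := 4 * D + 2 * D * (1 + D) in lev *.
have D0 : 0 <= D by apply: le_trans XD; apply: Ex_ge0 => w; exact: powR_ge0.
have c0 : 0 <= c by rewrite /c addr_ge0 ?mulr_ge0 ?addr_ge0.
have g0 : gam != 0 by rewrite gt_eqF//; lra.
have al0 : 0 <= al by apply: le_trans (XY _ _ measurable0 measurable0).
have th0 : 1 - 2 / gam != 0.
  by rewrite subr_eq0 eq_sym; apply/eqP => /(divr1_eq); lra.
(* For [al = 0] the balancing level would be infinite, so an arbitrary error [e] is reached with a
   large finite [a]; dividing by [c + 1] covers the case [c = 0]. *)
have [al_eq0|alpos] := eqVneq al 0.
  rewrite al_eq0 powR0// mulr0; apply/ler_addgt0Pr => e e0; rewrite add0r.
  pose a := Num.max 1 ((e / (c + 1)) `^ (2 - gam)^-1).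
  have a1 : 1 <= a by rewrite le_max lexx.
  have := lev a a1; rewrite al_eq0 mulr0 add0r => /le_trans; apply.
  have q0 : 0 < e / (c + 1) by rewrite divr_gt0//; lra.
  have : a `^ (2 - gam) <= e / (c + 1).
    have -> : e / (c + 1) = ((e / (c + 1)) `^ (2 - gam)^-1) `^ (2 - gam).
      by rewrite -powRrM mulVf ?powRr1 ?ltW// lt_eqF//; lra.
    have r0 : 0 < (e / (c + 1)) `^ (2 - gam)^-1 by exact: powR_gt0.
    rewrite -[X in _ `^ X <= _ `^ X]opprB !powRN lef_pV2 ?posrE ?powR_gt0//; last by rewrite (lt_le_trans ltr01).
    apply: ge0_ler_powR; rewrite ?nnegrE ?subr_ge0 ?opprB.
    - exact: ltW.
    - exact: ltW.
    - exact: le_trans a1.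
    - by rewrite /a le_max lexx orbT.
  rewrite ler_pdivlMr; last lra.
  by have := powR_ge0 a (2 - gam); nra.
have {}alpos : 0 < al by rewrite lt_def alpos.
have a1 : 1 <= al `^ (- gam^-1).
  have e1 : 1 = 1 `^ gam^-1 :> R by rewrite powR1.
  rewrite powRN invf_ge1 ?powR_gt0// [leRHS]e1.
  by apply: ge0_ler_powR; rewrite ?nnegrE ?invr_ge0//; lra.
have := lev _ a1; rewrite -powR_mulrn ?powR_ge0// -!powRrM.
have -> : - gam^-1 * (2 - gam) = 1 - 2 / gam by field.
rewrite -mulrA -{2}(powRr1 al0) -powRD ?(gt_eqF alpos) ?implybT//.
have -> : - gam^-1 * 2 + 1 = 1 - 2 / gam by field.
by rewrite -mulrDl /c addrA.
Qed.

End Davydov.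

(** * Mean square of time averages of dependent variables *)

Lemma sum_distn_le (R : realType) (b : nat -> R) (B : R) (n j : nat) :
  (forall h, 0 <= b h) -> (forall n, \sum_(0 <= h < n) b h <= B) -> (j < n)%N ->
  \sum_(0 <= l < n) b ((j - l) + (l - j))%N <= 2 * B.
Proof.
(* With truncated subtraction the argument of [b] is the distance from [j] to [l]; each side of [j]
   contributes at most [B]. *)
move=> b0 bB jn; rewrite (@big_cat_nat _ _ _ j.+1)//= mulr_natl mulr2n lerD//.
  rewrite big_nat_rev /= add0n (le_trans _ (bB j.+1))// ler_sum_nat// => l lj.
  by rewrite (_ : (j - _ + _)%N = l)//; lia.
rewrite -{1}(add0n j.+1) big_addn (le_trans _ (bB (n - j.+1).+1))//.
rewrite [leRHS]big_nat_recl//= -[leLHS]add0r lerD// ler_sum_nat// => l lj.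
by rewrite (_ : (j - _ + _)%N = l.+1)//; lia.
Qed.

Section MeanSquare.
Context d (T : measurableType d) (R : realType) (P : probability T R).
Local Notation Ex := (@Ex _ T R P).
Local Notation integ := (@integ _ T R P).

(** The sum has [n - k] terms but is divided by [n], whence a bias [k%:R * mm / n%:R], the source of
    the second term of the bound. The first comes from the summable covariances; the factor 2 common
    to both is that of (u - v)^2 <= 2 u^2 + 2 v^2. *)
Lemma mean_square_time_average (Z : nat -> T -> R) (mm B : R) (b : nat -> R)
    (k n : nat) :
  (forall t, integ (Z t)) -> (forall s t, integ (fun w => Z s w * Z t w)) ->
  (forall t, Ex (Z t) = mm) ->
  (forall h, 0 <= b h) -> (forall n, \sum_(0 <= h < n) b h <= B) ->
  (forall s h, `|Ex (fun w => Z s w * Z (s + h)%N w) - mm * mm| <= b h) ->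
  (k <= n)%N -> (0 < n)%N ->
  let A := fun w => n%:R^-1 * (\sum_(k.+1 <= t < n.+1) Z t w) - mm in
  integ (fun w => A w ^+ 2) /\
  Ex (fun w => A w ^+ 2) <= (4 * B + 2 * k%:R ^+ 2 * mm ^+ 2) / n%:R.
Proof.
move=> iZ iZZ EZ b0 bB cov kn n0 A.
pose L := (n - k)%N; pose Y (j : 'I_L) := fun w => Z (j + k.+1)%N w - mm.
have iYY j l : integ (fun w => Y j w * Y l w).
  rewrite (_ : (fun w => _) = fun w => Z (j + k.+1)%N w * Z (l + k.+1)%N w
     - mm * Z (j + k.+1)%N w - mm * Z (l + k.+1)%N w + mm * mm); last first.
    by apply/funext => w; rewrite /Y; ring.
  apply: integD; last exact: integ_cst.
  by apply/integB; [apply/integB => //|]; exact: integZ.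
have EYY j l : `|Ex (fun w => Y j w * Y l w)| <= b ((j - l) + (l - j))%N.
  have -> : Ex (fun w => Y j w * Y l w) =
      Ex (fun w => Z (j + k.+1)%N w * Z (l + k.+1)%N w) - mm * mm.
    transitivity (Ex (fun w => Z (j + k.+1)%N w * Z (l + k.+1)%N w
      - mm * Z (j + k.+1)%N w - mm * Z (l + k.+1)%N w + mm * mm)).
      by congr (Ex _); apply/funext => w; rewrite /Y; ring.
    rewrite ExD; [|by apply/integB; [apply/integB => //|]; exact: integZ|exact: integ_cst].
    rewrite Ex_cst ExB; [|by apply/integB => //; exact: integZ|exact: integZ].
    rewrite ExB//; last exact: integZ.
    by rewrite !(ExZ _ (iZ _)) !EZ; ring.
  have [jl|lj] := leqP j l.
    have -> : (l + k.+1 = (j + k.+1) + (j - l + (l - j)))%N by lia.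
    exact: cov.
  rewrite (_ : (fun w => _) = fun w => Z (l + k.+1)%N w * Z (j + k.+1)%N w); last first.
    by apply/funext => w; rewrite mulrC.
  have -> : (j + k.+1 = (l + k.+1) + (j - l + (l - j)))%N by lia.
  exact: cov.
pose S := fun w => \sum_(j < L) Y j w.
have S2 w : S w ^+ 2 = \sum_(j < L) \sum_(l < L) Y j w * Y l w.
  by rewrite expr2 big_distrlr.
have iS : integ (fun w => S w ^+ 2).
  rewrite (_ : (fun w => _) = fun w => \sum_(j < L) \sum_(l < L) Y j w * Y l w).
    by apply: integ_sum => j; exact: integ_sum.
  by apply/funext => w.
have nz : n%:R != 0 :> R by rewrite pnatr_eq0 -lt0n.
have npos : 0 < n%:R :> R by rewrite ltr0n.
have AE w : A w = n%:R^-1 * S w - k%:R * mm / n%:R.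
  rewrite /A /S /Y sumrB sumr_const card_ord.
  rewrite -[k.+1 in LHS]add0n big_addn subSS big_mkord -/L -[mm *+ L]mulr_natl.
  rewrite {1}(_ : mm = n%:R^-1 * (L%:R * mm) + k%:R * mm / n%:R).
    by rewrite mulrBr opprD addrA.
  have -> : L%:R = n%:R - k%:R :> R by rewrite /L natrB.
  by field.
have ES : Ex (fun w => S w ^+ 2) <= n%:R * (2 * B).
  rewrite (_ : (fun w => _) = fun w => \sum_(j < L) \sum_(l < L) Y j w * Y l w); last first.
    by apply/funext => w.
  rewrite Ex_sum; last by move=> j; exact: integ_sum.
  apply: (@le_trans _ _ (\sum_(j < L) (2 * B))).
    apply: ler_sum => j _; rewrite Ex_sum//.
    apply: le_trans (sum_distn_le b0 bB (ltn_ord j)); rewrite big_mkord.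
    by apply: ler_sum => l _; rewrite (le_trans (ler_norm _))// EYY.
  rewrite sumr_const card_ord -[leLHS]mulr_natl ler_wpM2r ?ler_nat ?leq_subr//.
  by rewrite mulr_ge0// (le_trans _ (bB 0%N))// big_geq.
have A2 w : A w ^+ 2 <= 2 * n%:R^-1 ^+ 2 * S w ^+ 2 + 2 * (k%:R * mm / n%:R) ^+ 2.
  rewrite AE; set u := n%:R^-1 * S w; set v := _ / _.
  have -> : 2 * n%:R^-1 ^+ 2 * S w ^+ 2 = 2 * u ^+ 2 by rewrite /u; ring.
  have := sqr_ge0 (u + v); nra.
have iB : integ (fun w => 2 * n%:R^-1 ^+ 2 * S w ^+ 2 + 2 * (k%:R * mm / n%:R) ^+ 2).
  by apply: integD; [exact: integZ|exact: integ_cst].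
have mA : measurable_fun setT A.
  apply: measurable_funB => //; apply: measurable_funM => //.
  by apply: measurable_sum => t; exact: integ_measurable (iZ t).
have iA : integ (fun w => A w ^+ 2).
  apply: integ_dominated iB _ => [|w]; first exact: measurable_funX.
  by rewrite ger0_norm ?sqr_ge0.
split => //; apply: le_trans (Ex_le iA iB A2) _.
rewrite ExD; [|exact: integZ|exact: integ_cst].
rewrite Ex_cst ExZ// -lerBrDr.
apply: (@le_trans _ _ (2 * n%:R^-1 ^+ 2 * (n%:R * (2 * B)))).
  by rewrite ler_wpM2l// mulr_ge0// sqr_ge0.
rewrite lerBrDr -subr_ge0.
have n1 : 1 <= n%:R :> R by rewrite ler1n.
have -> : (4 * B + 2 * k%:R ^+ 2 * mm ^+ 2) / n%:R -
  (2 * n%:R^-1 ^+ 2 * (n%:R * (2 * B)) + 2 * (k%:R * mm / n%:R) ^+ 2) =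
  2 * (k%:R * mm / n%:R) ^+ 2 * (n%:R - 1) by field.
by rewrite mulr_ge0 ?subr_ge0// mulr_ge0 ?sqr_ge0.
Qed.

End MeanSquare.

(** * The factor model *)

(** Both expectations are integrals of the identity against the same image measure. Strict
    stationarity reaches expectations this way. *)
Lemma Ex_eq_law d (T : measurableType d) (R : realType) (P : probability T R)
    (X Y : T -> R) : integ P X -> integ P Y ->
  (forall A : set R, measurable A -> P (X @^-1` A) = P (Y @^-1` A)) ->
  Ex P X = Ex P Y.
Proof.
move=> iX iY XY.
have mX := integ_measurable iX; have mY := integ_measurable iY.
pose X' : {RV P >-> R} := mfun_Sub (mem_set mX).
pose Y' : {RV P >-> R} := mfun_Sub (mem_set mY).
have eX : (\int[distribution P X']_y y%:E = \int[P]_w (X w)%:E)%E.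
  by rewrite integral_distribution.
have eY : (\int[distribution P Y']_y y%:E = \int[P]_w (Y w)%:E)%E.
  by rewrite integral_distribution.
rewrite /Ex /Rintegral -eX -eY; congr fine.
by apply: eq_measure_integral => A mA _; exact: XY.
Qed.

Section ModelProbability.
Variables (R : realType) (K N : nat) (m : panel R K N).
Local Notation P := (pPr m).
Local Notation zst := (@zstate R K N m).
Local Notation sig := (@sigma_field R K N m).

Lemma measurable_zstate t : measurable_fun setT (zst t).
Proof.
apply/measurable_fun_tnthP => i.
case: (split_ordP i) => j ->.
  rewrite (_ : _ \o _ = py m t j)//; apply/funext => w /=.
  by rewrite tnth_lshift tnth_mktuple.
rewrite (_ : _ \o _ = pf m t j)//; apply/funext => w /=.
by rewrite tnth_rshift tnth_mktuple.
Qed.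

(* Reads the factors and, through the model equation, the innovations off the
   observable state; the coordinates are ordered as the columns of
   [row_mx Lambda (invmx SN)]. *)
Definition read_source (a : 'I_(K + N)) (z : (N + K).-tuple R) : R :=
  match fintype.split a with
  | inl l => tnth z (rshift N l)
  | inr i => \sum_j SN m i j * tnth z (lshift K j)
             - \sum_l pB m i l * tnth z (rshift N l)
  end.

Definition source (t : int) (a : 'I_(K + N)) (w : pOm m) : R :=
  read_source a (zst t w).

Lemma measurable_read_source a : measurable_fun setT (read_source a).
Proof.
rewrite /read_source; case: fintype.split => [l|i]; first exact: measurable_tnth.
by apply: measurable_funB; apply: measurable_sum => j;
  apply: measurable_funM => //; exact: measurable_tnth.
Qed.

Lemma measurable_source t a : measurable_fun setT (source t a).
Proof.
exact: measurableT_comp (measurable_read_source a) (measurable_zstate t).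
Qed.

Lemma source_lshift t l : source t (lshift N l) = pf m t l.
Proof.
apply/funext => w; rewrite /source /read_source.
by rewrite (@unsplitK K N (inl l)) tnth_rshift tnth_mktuple.
Qed.

Hypothesis hmodel : model_equation m.

Lemma source_rshift t i : source t (rshift K i) = peps m t i.
Proof.
apply/funext => w; rewrite /source /read_source (@unsplitK K N (inr i)).
under eq_bigr do rewrite tnth_lshift tnth_mktuple.
under [X in _ - X]eq_bigr do rewrite tnth_rshift tnth_mktuple.
have yE : rvec (peps m t) w = SN m *m rvec (py m t) w - pB m *m rvec (pf m t) w.
  rewrite /SN mulmxBl mul1mx {1}(hmodel t w); apply/matrixP => u v.
  by rewrite !mxE; ring.
have -> : peps m t i w = rvec (peps m t) w i 0 by rewrite mxE.
rewrite yE [RHS]mxE [X in _ = _ + X]mxE; congr (_ - _).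
  by rewrite [RHS]mxE; apply: eq_bigr => j _; congr (_ * _); rewrite mxE.
by rewrite [RHS]mxE; apply: eq_bigr => j _; congr (_ * _); rewrite mxE.
Qed.

Let past (I : set int) := [set A : set (pOm m) | exists (t : int)
  (E : set ((N + K).-tuple R)), [/\ I t, measurable E & A = zst t @^-1` E] ].

Lemma sigma_field_sub (I : set int) (A : set (pOm m)) :
  sig I A -> measurable A.
Proof.
apply: smallest_sub; first exact: sigma_algebra_measurable.
move=> _ [t [E [_ mE ->]]]; rewrite -[X in measurable X]setTI.
exact: measurable_zstate.
Qed.

Lemma sigma_field_product (I : set int) s t a b (A : set R) : I s -> I t ->
  measurable A ->
  sig I ((fun w => source s a w * source t b w) @^-1` A).
Proof.
move=> Is It mA.
have mz u : I u -> measurable_fun (setT : set (g_sigma_algebraType (past I)))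
    (zst u : g_sigma_algebraType (past I) -> _).
  move=> Iu _ E mE; rewrite setTI; apply: sub_sigma_algebra; exists u, E; split => //.
have ms u c : I u -> measurable_fun (setT : set (g_sigma_algebraType (past I)))
    (source u c : g_sigma_algebraType (past I) -> R).
  by move=> Iu; exact: measurableT_comp (measurable_read_source c) (mz _ Iu).
have mst := measurable_funM (ms _ a Is) (ms _ b It).
by have := mst measurableT A mA; rewrite setTI.
Qed.

Lemma fine_abse_cov (A B : set (pOm m)) : measurable A -> measurable B ->
  fine `|P (A `&` B) - P A * P B|%E =
  `|fine (P (A `&` B)) - fine (P A) * fine (P B)|.
Proof.
move=> mA mB; have mAB := measurableI _ _ mA mB.
have fP (X : set (pOm m)) : measurable X -> P X \is a fin_num by exact: fin_num_measure.
by rewrite fine_abse ?fineB ?fineM// ?fin_numB ?fin_numM ?fP.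
Qed.

Lemma cov_prob_le1 (A B : set (pOm m)) : measurable A -> measurable B ->
  `|fine (P (A `&` B)) - fine (P A) * fine (P B)| <= 1.
Proof.
move=> mA mB; have /andP[a0 a1] := fine_prob_le1 P mA.
have /andP[b0 b1] := fine_prob_le1 P mB.
have /andP[c0 c1] := fine_prob_le1 P (measurableI _ _ mA mB).
have ab0 := mulr_ge0 a0 b0; have ab1 := mulr_ile1 a0 b0 a1 b1.
by rewrite ler_norml; apply/andP; split; lra.
Qed.

(** Boundedness is what makes the real supremum in [alpha] dominate its members. *)
Let alpha_set_ub (k : nat) : ubound [set x : R | exists (i : int) (A B : set (pOm m)),
    [/\ sig [set t | t <= i] A,
        sig [set t | i + k%:Z <= t] B
      & x = fine `|P (A `&` B) - P A * P B|%E] ] 1.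
Proof.
move=> _ [i [A [B [/sigma_field_sub mA /sigma_field_sub mB ->]]]].
by rewrite fine_abse_cov// cov_prob_le1.
Qed.

Lemma alpha_le1 k : alpha m k <= 1.
Proof.
apply: ge_sup; last exact: alpha_set_ub.
exists (fine `|P (set0 `&` set0) - P set0 * P set0|%E), 0, set0, set0.
by split => //; exact: sigma_algebra0.
Qed.

(** The first product reaches forward only to the date [s], the second back only to [h - l], which
    leaves a gap of at least [k] dates between them. *)
Lemma mixing_product (s h : int) (k l : nat) a b c e : s + k%:Z <= h - l%:Z ->
  mixing_le P (fun w => source s a w * source (s - l%:Z) b w)
              (fun w => source h c w * source (h - l%:Z) e w) (alpha m k).
Proof.
move=> skh A B mA mB.
have sA : sig [set t | t <= s]
    ((fun w => source s a w * source (s - l%:Z) b w) @^-1` A).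
  by apply: sigma_field_product => //=; lia.
have sB : sig [set t | s + k%:Z <= t]
    ((fun w => source h c w * source (h - l%:Z) e w) @^-1` B).
  by apply: sigma_field_product => //=; lia.
rewrite -fine_abse_cov; [|exact: sigma_field_sub sA|exact: sigma_field_sub sB].
apply: ub_le_sup; first by exists 1; exact: alpha_set_ub.
by exists s; do 2!eexists; split; [exact: sA|exact: sB|].
Qed.

Lemma mixing_le1 (X Y : pOm m -> R) : measurable_fun setT X ->
  measurable_fun setT Y -> mixing_le P X Y 1.
Proof.
by move=> mX mY A B mA mB; apply: cov_prob_le1; rewrite -[X in measurable X]setTI;
  [exact: mX|exact: mY].
Qed.

Hypothesis hstat : strictly_stationary m.

Lemma stationary_product (t l : int) a b (A : set R) : measurable A ->
  P ((fun w => source t a w * source (t + l) b w) @^-1` A) =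
  P ((fun w => source 0 a w * source l b w) @^-1` A).
Proof.
move=> mA.
pose g (z : 2.-tuple ((N + K).-tuple R)) :=
  read_source a (tnth z ord0) * read_source b (tnth z ord_max).
have mg : measurable_fun setT g.
  by apply: measurable_funM; apply: measurableT_comp (measurable_read_source _) _;
    exact: measurable_tnth.
have mE : measurable (g @^-1` A) by rewrite -[X in measurable X]setTI; exact: mg.
have := hstat [tuple 0; l] t mE.
rewrite /g /preimage /=.
under eq_set do rewrite !tnth_mktuple.
under [X in _ = _ X -> _]eq_set do rewrite !tnth_mktuple.
rewrite !(tnth_nth 0) /= add0r addrC => H.
exact: H.
Qed.

End ModelProbability.

Lemma Ex_le_of_expectation d (T : measurableType d) (R : realType)
    (P : probability T R) (f : T -> R) (c : R) :
  measurable_fun setT f -> (forall w, 0 <= f w) -> ('E_P[f] < c%:E)%E ->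
  integ P f /\ Ex P f <= c.
Proof.
move=> mf f0 lt; have jf := integ_of_expectation mf f0 lt; split => //.
rewrite -lee_fin /Ex /Rintegral fineK; last exact: integrable_fin_num.
by move: lt; rewrite unlock => /ltW.
Qed.

(** * Mean square error of the sample autocovariances of the sources *)

Section Autocovariance.
Variables (R : realType) (K N : nat) (m : panel R K N) (gam C : R).
Local Notation P := (pPr m).
Local Notation source := (@source R K N m).
Hypotheses (hgam : 2 < gam) (hmodel : model_equation m)
  (hstat : strictly_stationary m)
  (hmix : (\sum_(1 <= k <oo) ((alpha m k) `^ (1 - 2 / gam))%:E <= C%:E)%E)
  (hfmom : forall t j,
     ('E_P[fun w => (`|pf m t j w| `^ (2 * gam))%R] < C%:E)%E)
  (hemom : forall t i,
     ('E_P[fun w => (`|peps m t i w| `^ (2 * gam))%R] < C%:E)%E).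

Lemma measurable_norm_powR (X : pOm m -> R) p : measurable_fun setT X ->
  measurable_fun setT (fun w => `|X w| `^ p).
Proof.
move=> mX; apply: (measurableT_comp (measurable_powR p)).
exact: measurableT_comp.
Qed.

Lemma source_moment t a : integ P (fun w => `|source t a w| `^ (2 * gam)) /\
  Ex P (fun w => `|source t a w| `^ (2 * gam)) <= C.
Proof.
apply: Ex_le_of_expectation.
- exact/measurable_norm_powR/measurable_source.
- by move=> w; exact: powR_ge0.
- case: (split_ordP a) => i ->; first by rewrite source_lshift; exact: hfmom.
  by rewrite source_rshift//; exact: hemom.
Qed.

Lemma product_moment s t a b :
  integ P (fun w => `|source s a w * source t b w| `^ gam) /\
  Ex P (fun w => `|source s a w * source t b w| `^ gam) <= 2 * C.
Proof.
have [ia Ea] := source_moment s a; have [ib Eb] := source_moment t b.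
have mp : measurable_fun setT (fun w => `|source s a w * source t b w| `^ gam).
  by apply: measurable_norm_powR; apply: measurable_funM; exact: measurable_source.
have le w : `|source s a w * source t b w| `^ gam <=
    `|source s a w| `^ (2 * gam) + `|source t b w| `^ (2 * gam).
  exact: powR_mul_le.
have ip : integ P (fun w => `|source s a w * source t b w| `^ gam).
  apply: integ_dominated (integD ia ib) _ => // w.
  by rewrite ger0_norm ?powR_ge0.
split => //; apply: le_trans (Ex_le ip (integD ia ib) le) _.
rewrite (ExD ia ib) (_ : 2 * C = C + C); last by rewrite mulr_natl mulr2n.
exact: lerD Ea Eb.
Qed.

Lemma measurable_product s t a b :
  measurable_fun setT (fun w => source s a w * source t b w).
Proof. by apply: measurable_funM; exact: measurable_source. Qed.

Lemma integ_product s t a b : integ P (fun w => source s a w * source t b w).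
Proof.
have [ip _] := product_moment s t a b.
apply: integ_dominated (integD (integ_cst P 1) ip) _ => [|w].
  exact: measurable_product.
exact: norm_le_1powR.
Qed.

Lemma Ex_product_le s t a b :
  `|Ex P (fun w => source s a w * source t b w)| <= 1 + 2 * C.
Proof.
have [ip Ep] := product_moment s t a b.
apply: (@le_trans _ _ (Ex P (fun w => 1 + `|source s a w * source t b w| `^ gam))).
  apply: Ex_norm_le => [||w]; first exact: measurable_product.
    by apply: integD => //; exact: integ_cst.
  exact: norm_le_1powR.
by rewrite ExD ?Ex_cst ?lerD2l//; exact: integ_cst.
Qed.

Definition davydov_constant : R :=
  4 + 4 * (2 * C) + 2 * (2 * C) * (1 + 2 * C).

(** A product at lag [k] spans the dates t - k to t. For [h <= k] two spans at distance [h] overlap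
    or touch and the trivial mixing coefficient 1 is used; beyond, the gap is [h - k]. *)
Definition lag_bound (k h : nat) : R :=
  davydov_constant *
    (if (h <= k)%N then 1 else (alpha m (h - k)) `^ (1 - 2 / gam)).

Let theta_sum n : \sum_(1 <= i < n) (alpha m i) `^ (1 - 2 / gam) <= C.
Proof.
rewrite -lee_fin -sumEFin; apply: le_trans hmix.
by apply: nneseries_lim_ge => i _ _; rewrite lee_fin powR_ge0.
Qed.

Let C0 : 0 <= C.
Proof. by have := theta_sum 0; rewrite big_geq. Qed.

Lemma davydov_constant_ge0 : 0 <= davydov_constant.
Proof. by rewrite /davydov_constant !addr_ge0 ?mulr_ge0 ?addr_ge0 ?mulr_ge0. Qed.

Lemma lag_bound_ge0 k h : 0 <= lag_bound k h.
Proof.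
by rewrite mulr_ge0 ?davydov_constant_ge0//; case: ifP => // _; exact: powR_ge0.
Qed.

Lemma sum_lag_bound k n :
  \sum_(0 <= h < n) lag_bound k h <= davydov_constant * (k.+1%:R + C).
Proof.
(* The range is lengthened so that, for every [n], it can be split after the first [k.+1] lags. *)
apply: (@le_trans _ _ (\sum_(0 <= h < n + k.+1) lag_bound k h)).
  rewrite [leRHS](@big_cat_nat _ _ _ n)//= ?leq_addr// lerDl.
  by apply: sumr_ge0 => h _; exact: lag_bound_ge0.
rewrite (@big_cat_nat _ _ _ k.+1)//= ?leq_addl// mulrDr lerD//.
  rewrite (eq_big_nat _ _ (F2 := fun=> davydov_constant)); last first.
    by move=> h /andP[_ hk]; rewrite /lag_bound -ltnS hk mulr1.
  by rewrite sumr_const_nat subn0 -[leLHS]mulr_natr.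
rewrite -{1}[k.+1]add1n big_addn addnS subSn ?leq_addl// addnK.
rewrite (eq_big_nat _ _ (F2 := fun i => davydov_constant * (alpha m i) `^ (1 - 2 / gam))).
  by rewrite -mulr_sumr ler_wpM2l// davydov_constant_ge0.
by move=> h /andP[h1 _]; rewrite /lag_bound addnK -{2}[k]add0n leq_add2r leqNgt h1.
Qed.

Definition autocov_error k n a b (w : pOm m) : R :=
  n%:R^-1 * (\sum_(k.+1 <= t < n.+1) source t%:Z a w * source (t%:Z - k%:Z) b w)
  - Ex P (fun w => source 0 a w * source (- k%:Z) b w).

Definition autocov_constant (k : nat) : R :=
  4 * (davydov_constant * (k.+1%:R + C)) + 2 * k%:R ^+ 2 * (1 + 2 * C) ^+ 2.

Lemma autocov_error_mean_square k n a b : (k <= n)%N -> (0 < n)%N ->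
  integ P (fun w => autocov_error k n a b w ^+ 2) /\
  Ex P (fun w => autocov_error k n a b w ^+ 2) <= autocov_constant k / n%:R.
Proof.
move=> kn n0.
pose Z (t : nat) w := source t%:Z a w * source (t%:Z - k%:Z) b w.
pose mm := Ex P (fun w => source 0 a w * source (- k%:Z) b w).
have mZ t : measurable_fun setT (Z t) by exact: measurable_product.
have iZ t : integ P (Z t) by exact: integ_product.
have EZ t : Ex P (Z t) = mm.
  apply: Ex_eq_law => //; first exact: integ_product.
  by move=> A mA; exact: stationary_product.
have pZ t := product_moment t%:Z (t%:Z - k%:Z) a b.
have iZZ s t : integ P (fun w => Z s w * Z t w).
  have [ps _] := pZ s; have [pt _] := pZ t.
  apply: integ_dominated (integD (integ_cst P 2) (integD ps pt)) _ => [|w].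
    exact: measurable_funM.
  exact: norm_mul_le_2powR.
have cov s h : `|Ex P (fun w => Z s w * Z (s + h)%N w) - mm * mm| <= lag_bound k h.
  have dav al : al <= 1 -> mixing_le P (Z s) (Z (s + h)%N) al ->
      `|Ex P (fun w => Z s w * Z (s + h)%N w) - mm * mm| <=
      davydov_constant * al `^ (1 - 2 / gam).
    move=> al1 mix; have -> : mm * mm = Ex P (Z s) * Ex P (Z (s + h)%N) by rewrite !EZ.
    have [ps Es] := pZ s; have [pt Et] := pZ (s + h)%N.
    exact: (davydov hgam (mZ s) (mZ (s + h)%N) ps pt Es Et mix al1).
  rewrite /lag_bound; case: leqP => hk.
    rewrite -[X in _ <= _ * X](_ : 1 `^ (1 - 2 / gam) = 1); last by rewrite powR1.
    exact: dav (lexx _) (mixing_le1 (mZ _) (mZ _)).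
  apply: dav; first exact: alpha_le1.
  by apply: mixing_product; lia.
have [iA EA] := mean_square_time_average iZ iZZ EZ (lag_bound_ge0 k)
  (sum_lag_bound k) cov kn n0.
split => //; apply: le_trans EA _.
rewrite ler_wpM2r ?invr_ge0// lerD2l ler_wpM2l ?mulr_ge0 ?sqr_ge0//.
rewrite -(real_normK (num_real mm)) lerXn2r ?nnegrE ?addr_ge0 ?mulr_ge0//.
exact: Ex_product_le.
Qed.

End Autocovariance.

(** * Factorisation of the panel autocovariances through the sources *)

Lemma fine_covariance_centered d (T : measurableType d) (R : realType)
    (P : probability T R) (X Y : T -> R) :
  ('E_P[X] = 0)%E -> ('E_P[Y] = 0)%E ->
  fine (covariance P X Y) = Ex P (fun w => X w * Y w).
Proof.
move=> EX EY; rewrite unlock EX EY /= unlock; congr fine.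
apply: eq_integral => w _; congr (_%:E).
by change ((X w - 0) * (Y w - 0) = X w * Y w); rewrite !subr0.
Qed.

Section AutocovarianceFactorization.
Variables (R : realType) (K N : nat) (m : panel R K N).
Local Notation P := (pPr m).
Local Notation source := (@source R K N m).
Hypotheses (hmodel : model_equation m) (hS : SN m \in unitmx)
  (hy0 : forall t i, ('E_P[py m t i] = 0)%E)
  (he0 : forall t i, ('E_P[peps m t i] = 0)%E)
  (hyeps : forall (t : int) (j : nat), (1 <= j)%N ->
     Covmx (py m (t - j%:Z)) (peps m t) = 0)
  (iprod : forall s t a b, integ P (fun w => source s a w * source t b w)).

Definition mixing_matrix : 'M[R]_(N, K + N) := row_mx (Lambda m) (invmx (SN m)).
Local Notation L := mixing_matrix.

Lemma rvec_pyE t w : rvec (py m t) w = L *m \col_a source t a w.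
Proof.
have yE : SN m *m rvec (py m t) w = pB m *m rvec (pf m t) w + rvec (peps m t) w.
  rewrite /SN mulmxBl mul1mx {1}(hmodel t w); apply/matrixP => u v.
  by rewrite !mxE; ring.
have -> : \col_a source t a w = col_mx (rvec (pf m t) w) (rvec (peps m t) w).
  apply/colP => a; rewrite mxE; case: (split_ordP a) => i ->.
    by rewrite col_mxEu mxE source_lshift.
  by rewrite col_mxEd mxE source_rshift.
rewrite mul_row_col /Lambda -mulmxA -mulmxDr -yE mulmxA mulVmx//.
by rewrite mul1mx.
Qed.

Lemma pyE t i w : py m t i w = \sum_a L i a * source t a w.
Proof.
have /matrixP/(_ i 0) := rvec_pyE t w; rewrite [LHS]mxE [RHS]mxE => ->.
by apply: eq_bigr => a _; congr (_ * _); rewrite mxE.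
Qed.

Definition source_autocov (k : nat) : 'M[R]_(K + N) :=
  \matrix_(a, b) Ex P (fun w => source 0 a w * source (- k%:Z) b w).

Lemma source_py_cov (t : int) a j :
  integ P (fun w => source 0 a w * py m t j w) /\
  Ex P (fun w => source 0 a w * py m t j w) =
  \sum_b Ex P (fun w => source 0 a w * source t b w) * L j b.
Proof.
have e : (fun w => source 0 a w * py m t j w) =
    fun w => \sum_b L j b * (source 0 a w * source t b w).
  apply/funext => w; rewrite pyE mulr_sumr; apply: eq_bigr => b _.
  by rewrite mulrCA.
have ib b : integ P (fun w => L j b * (source 0 a w * source t b w)).
  exact: integZ.
rewrite e; split; first exact: integ_sum.
by rewrite Ex_sum//; apply: eq_bigr => b _; rewrite ExZ// mulrC.
Qed.

Lemma Sigma_yE k : Sigma_y m k = L *m source_autocov k *m L^T.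
Proof.
apply/matrixP => i j.
rewrite mxE fine_covariance_centered//.
transitivity (Ex P (fun w => \sum_a L i a * (source 0 a w * py m (- k%:Z) j w))).
  congr (Ex _ _); apply/funext => w; rewrite pyE mulr_suml.
  by apply: eq_bigr => a _; rewrite mulrA.
rewrite Ex_sum => [|a]; last first.
  by apply: integZ; have [] := source_py_cov (- k%:Z) a j.
rewrite -mulmxA mxE; apply: eq_bigr => a _.
have [ia Ea] := source_py_cov (- k%:Z) a j.
rewrite ExZ// Ea; congr (_ * _); rewrite mxE; apply: eq_bigr => b _.
by rewrite !mxE.
Qed.

(* The innovation block of [source_autocov k *m L^T], that is
   [Cov (eps_0, y_(-k))], vanishes for [k >= 1]. *)
Lemma Sigma_y_Lambda k : (1 <= k)%N ->
  Sigma_y m k = Lambda m *m usubmx (source_autocov k *m L^T).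
Proof.
move=> k1; rewrite Sigma_yE -mulmxA -{1}[source_autocov k *m _]vsubmxK.
rewrite mul_row_col; set D := dsubmx _; suff -> : D = 0 by rewrite mulmx0 addr0.
apply/matrixP => i j; rewrite /D mxE [RHS]mxE [LHS]mxE.
have /matrixP/(_ j i) := hyeps 0 k1; rewrite sub0r !mxE fine_covariance_centered//.
move=> H.
have [_ E] := source_py_cov (- k%:Z) (rshift K i) j.
have {}H : Ex P (fun w => source 0 (rshift K i) w * py m (- k%:Z) j w) = 0.
  rewrite -[RHS]H; congr (Ex _ _); apply/funext => w.
  by rewrite source_rshift// mulrC.
rewrite -[RHS]H E; apply: eq_bigr => b _.
by rewrite !mxE.
Qed.

(** All lags are at least 1, so every term factors through [Lambda]. The middle sum is the K x K
    core whose smallest eigenvalue supplies the curvature. *)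
Lemma Mmx_compression k0 : Mmx m k0 = Lambda m *m
  (\sum_(1 <= k < k0.+1) usubmx (source_autocov k *m L^T) *m
     (usubmx (source_autocov k *m L^T))^T) *m (Lambda m)^T.
Proof.
rewrite /Mmx mulmx_sumr mulmx_suml; apply: eq_big_nat => k /andP[k1 _].
by rewrite Sigma_y_Lambda// trmx_mul !mulmxA.
Qed.

(** [autocov_error] keeps the range and the divisor of the estimator, so the identity has no
    remainder. *)
Lemma Sigma_y_hat_error T k w :
  Sigma_y_hat T k w =
  Sigma_y m k + L *m (\matrix_(a, b) @autocov_error R K N m k T a b w) *m L^T.
Proof.
rewrite Sigma_yE -mulmxDl -mulmxDr /Sigma_y_hat.
have -> : source_autocov k + \matrix_(a, b) autocov_error k T a b w =
  T%:R^-1 *: \sum_(k.+1 <= t < T.+1)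
    (\col_a source t%:Z a w) *m (\col_a source (t%:Z - k%:Z) a w)^T.
  apply/matrixP => a b; rewrite !mxE /autocov_error addrC subrK summxE.
  by congr (_ * _); apply: eq_bigr => t _; rewrite !mxE big_ord1 !mxE.
rewrite -scalemxAr -scalemxAl mulmx_sumr mulmx_suml; congr (_ *: _).
by apply: eq_bigr => t _; rewrite !rvec_pyE trmx_mul !mulmxA.
Qed.

End AutocovarianceFactorization.

(** * Loading error at outcomes where the sample error is small *)

Lemma unitmx_of_small_angle (R : rcfType) n k (Q U : 'M[R]_(n, k)) :
  U^T *m U = 1%:M -> sqfrob (U - Q *m (Q^T *m U)) < 1 -> Q^T *m U \in unitmx.
Proof.
(* A kernel vector [v] would make [U *m v^T] orthogonal to the columns of [Q]; the residual would
   then preserve the norm of [v], although its Frobenius norm is below 1. *)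
move=> UU small; rewrite -unitmx_tr unitmxE unitfE; apply/negP => /det0P[v v0 vZ].
have Zv : Q^T *m U *m v^T = 0 by rewrite -[RHS]trmx0 -vZ trmx_mul trmxK.
have vE : sqfrob v = sqfrob ((U - Q *m (Q^T *m U)) *m v^T).
  rewrite mulmxBl -mulmxA Zv mulmx0 subr0 sqfrobE mxtrace_mulC.
  rewrite [RHS]sqfrobE [RHS]mxtrace_mulC trmx_mul trmxK mulmxA -(mulmxA v) UU.
  by rewrite mulmx1 mxtrace_mulC.
have v_gt0 : 0 < sqfrob v.
  rewrite lt_def sqfrob_ge0 andbT; apply: contra v0 => /eqP s0; apply/eqP/rowP => j.
  move: s0; rewrite /sqfrob big_ord1 mxE => /eqP.
  rewrite psumr_eq0 => [|i _]; last exact: sqr_ge0.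
  by move=> /allP/(_ j); rewrite mem_index_enum sqrf_eq0 => /(_ isT)/eqP.
have := sqfrob_mulmx (U - Q *m (Q^T *m U)) v^T.
rewrite -vE sqfrob_tr leNgt => /negP; apply.
by rewrite -[ltRHS]mul1r ltr_pM2r.
Qed.

Lemma scalemx_sandwich (R : comNzRingType) n k (x : R) (A : 'M[R]_(n, k)) (X : 'M[R]_k) :
  (x *: A) *m X *m (x *: A)^T = A *m (x * x *: X) *m A^T.
Proof.
rewrite linearZ /= -[LHS]scalemxAr -!scalemxAl scalerA.
by rewrite -[in RHS]scalemxAr -[RHS]scalemxAl.
Qed.

Lemma frobE (R : realType) m n (A : 'M[R]_(m, n)) : frob A = Num.sqrt (sqfrob A).
Proof. by []. Qed.

Lemma gram_form_ge0 (R : realType) n (I : finType) (S : I -> 'M[R]_n) (v : 'rV[R]_n) :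
  0 <= (v *m (\sum_k S k *m (S k)^T) *m v^T) 0 0.
Proof.
rewrite mulmx_sumr mulmx_suml summxE; apply: sumr_ge0 => k _.
rewrite (mulmxA v) -(mulmxA (v *m S k)) -trmx_mul mxE; apply: sumr_ge0 => j _.
by rewrite [X in _ * X]mxE -expr2 sqr_ge0.
Qed.

Section LoadingError.
Variables (R : realType) (K N k0 : nat) (m : panel R K N) (gam C c : R).
Local Notation P := (pPr m).
Local Notation source := (@source R K N m).
Hypotheses (hKN : (K <= N)%N) (hN : (0 < N)%N) (hc : 0 < c)
  (hmodel : model_equation m) (hS : SN m \in unitmx)
  (hy0 : forall t i, ('E_P[py m t i] = 0)%E)
  (he0 : forall t i, ('E_P[peps m t i] = 0)%E)
  (hyeps : forall (t : int) (j : nat), (1 <= j)%N ->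
     Covmx (py m (t - j%:Z)) (peps m t) = 0)
  (iprod : forall s t a b, integ P (fun w => source s a w * source t b w))
  (Eprod : forall s t a b,
     `|Ex P (fun w => source s a w * source t b w)| <= 1 + 2 * C)
  (hSsum : forall i, \sum_j `|invmx (SN m) i j| <= C)
  (hBnorm : N%:R^-1 *: ((pB m)^T *m invmx (SN m)^T *m invmx (SN m) *m pB m) = 1%:M)
  (hM : nonzero_eigenvalues (Mmx m k0) K (c * N%:R ^+ 2)).

Local Notation L := (mixing_matrix m).

(** Per unit of N: [Lambda] has squared norm N K and K columns, which gives 2 K^2; the row sums of
    the inverse of [SN] give 2 C^2. *)
Definition weight_constant : R := 2 * K%:R ^+ 2 + 2 * C ^+ 2.

Lemma weight_constant_ge0 : 0 <= weight_constant.
Proof. by rewrite addr_ge0// mulr_ge0// sqr_ge0. Qed.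

Let N0 : 0 < N%:R :> R. Proof. by rewrite ltr0n. Qed.

Let sN2 : Num.sqrt N%:R * Num.sqrt N%:R = N%:R :> R.
Proof. by rewrite -expr2 sqr_sqrtr ?ltW. Qed.

Let sN0 : Num.sqrt N%:R != 0 :> R.
Proof. by rewrite gt_eqF// sqrtr_gt0. Qed.

Let Q : 'M[R]_(N, K) := (Num.sqrt N%:R)^-1 *: Lambda m.

Let LambdaE : Lambda m = Num.sqrt N%:R *: Q.
Proof. by rewrite /Q scalerA mulfV// scale1r. Qed.

Let QQ : Q^T *m Q = 1%:M.
Proof.
have -> : Q^T = (Num.sqrt N%:R)^-1 *: (Lambda m)^T by rewrite /Q linearZ.
rewrite /Q -scalemxAl -scalemxAr scalerA -invfM sN2 -hBnorm.
by rewrite /Lambda trmx_mul trmx_inv !mulmxA.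
Qed.

Lemma sum_weight_le : \sum_a source_weight L a <= N%:R * weight_constant.
Proof.
rewrite sum_source_weight.
apply: (le_trans (sum_sqr_row_abs_sum_row_mx _ hSsum)).
have -> : sqfrob (Lambda m) = N%:R * K%:R.
  by rewrite LambdaE sqfrobZ expr2 sN2 sqfrobE mxtrace_mulC QQ mxtrace1.
by rewrite /weight_constant le_eqVlt; apply/orP; left; apply/eqP; ring.
Qed.

Lemma sum_weight2_le (G : 'M[R]_(K + N)) (g : R) :
  (forall a b, G a b ^+ 2 <= g) -> 0 <= g ->
  \sum_a \sum_b source_weight L a * source_weight L b * G a b ^+ 2 <=
  (N%:R * weight_constant) ^+ 2 * g.
Proof.
move=> Gg g0.
have w0 := source_weight_ge0 L.
apply: (@le_trans _ _ (\sum_a \sum_b source_weight L a * source_weight L b * g)).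
  by apply: ler_sum => a _; apply: ler_sum => b _; rewrite ler_wpM2l// mulr_ge0.
under eq_bigr do rewrite -mulr_suml.
rewrite -mulr_suml -big_distrlr /= ler_wpM2r//.
have s0 : 0 <= \sum_a source_weight L a by exact: sumr_ge0.
by rewrite expr2 ler_pM// sum_weight_le.
Qed.

Definition weighted_error (T k : nat) (w : pOm m) : R :=
  \sum_a \sum_b source_weight L a * source_weight L b *
    @autocov_error R K N m k T a b w ^+ 2.

Lemma weighted_error_ge0 T k w : 0 <= weighted_error T k w.
Proof.
have w0 := source_weight_ge0 L.
by do 2!apply: sumr_ge0 => ? _; rewrite mulr_ge0 ?sqr_ge0// mulr_ge0.
Qed.

Definition total_error (T : nat) (w : pOm m) : R :=
  \sum_(k < k0) weighted_error T k.+1 w.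

(** The factor 2 of the angle bound, times the perturbation factor for [k0] lags, over the squared
    curvature (c N^2)^2; all powers of N cancel. *)
Definition angle_constant : R :=
  2 * (k0%:R * (3 * (1 + 2 * (weight_constant ^+ 2 * (1 + 2 * C) ^+ 2)))) / c ^+ 2.

Lemma angle_constant_ge0 : 0 <= angle_constant.
Proof.
by rewrite /angle_constant divr_ge0 ?sqr_ge0// mulr_ge0// mulr_ge0// mulr_ge0//
  addr_ge0// mulr_ge0// mulr_ge0 ?sqr_ge0.
Qed.

(** With this choice [H^T] equals [Q^T *m U] for [Q] the normalised [Lambda], so the loading error
    over sqrt N is exactly the residual [U - Q *m (Q^T *m U)] of the angle bound. *)
Lemma loading_error_bound T w (Lh : 'M[R]_(N, K)) (u : R) :
  loading_estimate k0 T w Lh -> u <= 1 -> total_error T w <= u * N%:R ^+ 2 ->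
  angle_constant * u < 1 ->
  let H := N%:R^-1 *: (Lh^T *m Lambda m) in
  H \in unitmx /\
  ((Num.sqrt N%:R)^-1 * frob (Lh - Lambda m *m H^T)) ^+ 2 <= angle_constant * u.
Proof.
move=> [U [UU [a [r [spec ra MU]]]] ->] u1 te small H.
have HE : H^T = Q^T *m U.
  have -> : H^T = N%:R^-1 *: ((Lambda m)^T *m (Num.sqrt N%:R *: U)).
    by rewrite /H linearZ /= trmx_mul trmxK.
  have -> : (Lambda m)^T = Num.sqrt N%:R *: Q^T by rewrite LambdaE linearZ.
  by rewrite -scalemxAl -scalemxAr !scalerA -mulrA sN2 mulVf ?scale1r// gt_eqF.
set Mh := Mmx_hat k0 T w in spec MU.
pose S (k : 'I_k0) := Sigma_y m k.+1.
pose E (k : 'I_k0) := L *m (\matrix_(a, b) autocov_error k.+1 T a b w) *m L^T.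
pose s (k : 'I_k0) := weighted_error T k.+1 w.
have MhE : Mh = \sum_k (S k + E k) *m (S k + E k)^T.
  rewrite /Mh /Mmx_hat big_add1 /= big_mkord; apply: eq_bigr => k _.
  by rewrite (Sigma_y_hat_error hmodel).
have ME : Mmx m k0 = \sum_k S k *m (S k)^T.
  by rewrite /Mmx big_add1 /= big_mkord.
have Es k : sqfrob (E k) <= s k.
  apply: (le_trans (sqfrob_sandwich _ _)); rewrite le_eqVlt; apply/orP; left.
  apply/eqP; apply: eq_bigr => i _; apply: eq_bigr => j _; congr (_ * _ ^+ 2).
  by rewrite mxE.
pose V : R := (N%:R * weight_constant) ^+ 2 * (1 + 2 * C) ^+ 2.
have SV k : sqfrob (S k) <= V.
  rewrite /S (Sigma_yE hmodel)//; apply: (le_trans (sqfrob_sandwich _ _)).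
  apply: sum_weight2_le; last exact: sqr_ge0.
  move=> i j; rewrite mxE -(real_normK (num_real (Ex _ _))).
  have e := Eprod 0 (- k.+1%:Z) i j.
  by rewrite lerXn2r ?nnegrE//; exact: le_trans e.
have N2 : 0 < N%:R ^+ 2 :> R by rewrite exprn_gt0.
(* Because [u <= 1], N^2 bounds each error; it has the order of [V] and plays the part of the a
   priori bound in [gram_perturbation]. *)
have sN k : s k <= N%:R ^+ 2.
  apply: (@le_trans _ _ (total_error T w)).
    rewrite /total_error (bigD1 k)//= lerDl sumr_ge0// => i _.
    exact: weighted_error_ge0.
  by apply: (le_trans te); rewrite ler_piMl// ltW.
have gp := gram_perturbation Es SV sN; rewrite -MhE -ME card_ord in gp.
pose X := \sum_(1 <= k < k0.+1) usubmx (source_autocov m k *m L^T) *m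
     (usubmx (source_autocov m k *m L^T))^T.
have symX : (N%:R *: X)^T = N%:R *: X.
  rewrite linearZ /= /X linear_sum /=; congr (_ *: _).
  by apply: eq_bigr => k _; rewrite trmx_mul trmxK.
have MQ : Mmx m k0 = Q *m (N%:R *: X) *m Q^T.
  by rewrite (Mmx_compression hmodel)//= -/X LambdaE scalemx_sandwich sN2.
have lo0 : 0 <= c * N%:R ^+ 2 by rewrite mulr_ge0// ltW.
(* The hypothesis on the non-zero eigenvalues of [Mmx] reaches the core [N%:R *: X] because [Q] has
   orthonormal columns. *)
have Xlo (v : 'rV_K) : c * N%:R ^+ 2 * (v *m v^T) 0 0 <= (v *m (N%:R *: X) *m v^T) 0 0.
  apply: rayleigh_ge => // x; have [sp [specM sp_lo]] := hM.
  rewrite /spectrum MQ in specM.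
  by move=> /(root_char_poly_compression hKN QQ specM)/sp_lo[].
have symMh : Mh^T = Mh.
  rewrite MhE linear_sum /=; apply: eq_bigr => k _.
  by rewrite trmx_mul trmxK.
have psdMh (v : 'rV_N) : 0 <= (v *m Mh *m v^T) 0 0.
  by rewrite MhE; exact: gram_form_ge0.
have dk := davis_kahan symMh psdMh UU spec ra MU QQ lo0 Xlo.
rewrite -MQ in dk.
have angle : sqfrob (U - Q *m (Q^T *m U)) <= angle_constant * u.
  have lo2 : 0 < (c * N%:R ^+ 2) ^+ 2 by rewrite exprn_gt0// mulr_gt0.
  rewrite -(ler_pM2l lo2); apply: (le_trans dk).
  rewrite (_ : _ * (angle_constant * u) = 2 * (k0%:R * (3 * (N%:R ^+ 2 + 2 * V))
      * (u * N%:R ^+ 2))); last first.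
    rewrite /angle_constant /V; field; exact: lt0r_neq0.
  rewrite ler_wpM2l//; apply: (le_trans gp); rewrite ler_wpM2l//.
  by rewrite mulr_ge0// mulr_ge0// addr_ge0 ?sqr_ge0// mulr_ge0// mulr_ge0 ?sqr_ge0.
split; first by rewrite -unitmx_tr HE (unitmx_of_small_angle UU)// (le_lt_trans angle).
rewrite HE LambdaE -scalemxAl -scalerBr frobE sqfrobZ exprMn sqr_sqrtr; last first.
  by rewrite mulr_ge0 ?sqr_ge0// sqfrob_ge0.
by rewrite exprVn mulrA mulVf ?mul1r// expf_neq0.
Qed.

End LoadingError.

Lemma total_error_mean (R : realType) (K N k0 : nat) (m : panel R K N) (C : R)
    (B : nat -> R) (T : nat) : (0 < N)%N ->
  (forall i, \sum_j `|invmx (SN m) i j| <= C) ->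
  N%:R^-1 *: ((pB m)^T *m invmx (SN m)^T *m invmx (SN m) *m pB m) = 1%:M ->
  (forall k a b, (k < k0)%N ->
    integ (pPr m) (fun w => @autocov_error R K N m k.+1 T a b w ^+ 2) /\
    Ex (pPr m) (fun w => @autocov_error R K N m k.+1 T a b w ^+ 2) <= B k) ->
  integ (pPr m) (total_error k0 (m := m) T) /\
  Ex (pPr m) (total_error k0 (m := m) T) <=
    (N%:R * weight_constant K C) ^+ 2 * \sum_(k < k0) B k.
Proof.
move=> hN hSsum hBnorm GB; set L := mixing_matrix m.
have w0 := source_weight_ge0 L.
have iab (k : 'I_k0) a b : integ (pPr m) (fun w => source_weight L a * source_weight L b *
    @autocov_error R K N m k.+1 T a b w ^+ 2).
  by apply: integZ; have [] := GB k a b (ltn_ord k).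
have ik (k : 'I_k0) : integ (pPr m) (weighted_error (m := m) T k.+1).
  by apply: integ_sum => a; apply: integ_sum => b; exact: iab.
split; first exact: integ_sum.
rewrite Ex_sum// mulr_sumr; apply: ler_sum => k _.
rewrite Ex_sum; last by move=> a; apply: integ_sum => b; exact: iab.
have Bk0 : 0 <= B k.
  have [_] := GB k (rshift K (Ordinal hN)) (rshift K (Ordinal hN)) (ltn_ord k).
  by apply: le_trans; apply: Ex_ge0 => w; exact: sqr_ge0.
apply: (@le_trans _ _ (\sum_a \sum_b source_weight L a * source_weight L b * B k)).
  apply: ler_sum => a _; rewrite Ex_sum//; apply: ler_sum => b _.
  have [iG EG] := GB k a b (ltn_ord k).
  by rewrite ExZ// ler_wpM2l// mulr_ge0.
(* [sum_weight2_le] speaks of squared entries, so it is applied to the constant matrix of square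
   roots. *)
have Bk2 : B k = Num.sqrt (B k) ^+ 2 by rewrite sqr_sqrtr.
have := @sum_weight2_le R K N m C hN hSsum hBnorm (const_mx (Num.sqrt (B k))) (B k) _ Bk0.
under eq_bigr do under eq_bigr do rewrite mxE -Bk2.
by apply => a b; rewrite mxE -Bk2.
Qed.

(** * Measurability and the random rotation *)

Lemma measurable_ge d (T : measurableType d) (R : realType) (f : T -> R) (c : R) :
  measurable_fun setT f -> measurable [set w | c <= f w].
Proof.
move=> mf; have -> : [set w | c <= f w] = setT `&` f @^-1` `[c, +oo[%classic.
  by apply/seteqP; split => w /=; rewrite in_itv/= andbT => // -[].
exact: mf.
Qed.

Lemma measurable_gt d (T : measurableType d) (R : realType) (f : T -> R) (c : R) :
  measurable_fun setT f -> measurable [set w | c < f w].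
Proof.
move=> mf; have -> : [set w | c < f w] = setT `&` f @^-1` `]c, +oo[%classic.
  by apply/seteqP; split => w /=; rewrite in_itv/= andbT => // -[].
exact: mf.
Qed.

Lemma measurable_det d (T : measurableType d) (R : realType) n (G : T -> 'M[R]_n) :
  (forall i j, measurable_fun setT (fun w => G w i j)) ->
  measurable_fun setT (fun w => \det (G w)).
Proof.
move=> mG; apply: measurable_sum => s; apply: measurable_funM => //.
exact: measurable_prod.
Qed.

Lemma measurable_frob d (T : measurableType d) (R : realType) p n (G : T -> 'M[R]_(p, n)) :
  (forall i j, measurable_fun setT (fun w => G w i j)) ->
  measurable_fun setT (fun w => frob (G w)).
Proof.
move=> mG; rewrite (_ : (fun w => _) = fun w => sqfrob (G w) `^ 2^-1).
  apply: (measurableT_comp (measurable_powR _)).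
  by do 2!apply: measurable_sum => ?; exact: measurable_funX.
by apply/funext => w; rewrite powR12_sqrt ?sqfrob_ge0.
Qed.

Section RotationMatrix.
Variables (R : realType) (K N : nat) (m : panel R K N).
Variable Lh : 'I_N -> 'I_K -> {RV (pPr m) >-> R}.

Definition rotation (w : pOm m) : 'M[R]_K :=
  N%:R^-1 *: ((rmx Lh w)^T *m Lambda m).

(** [rotation] may be singular at some outcomes. Replacing it there by the identity gives
    invertibility at every outcome and keeps the entries measurable. *)
Definition invertible_rotation (w : pOm m) : 'M[R]_K :=
  if \det (rotation w) == 0 then 1%:M else rotation w.

Lemma measurable_rotation i j : measurable_fun setT (fun w => rotation w i j).
Proof.
rewrite (_ : (fun w => _) = fun w => N%:R^-1 * \sum_l Lh l i w * Lambda m l j).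
  by apply: measurable_funM => //; apply: measurable_sum => l; exact: measurable_funM.
apply/funext => w; rewrite [LHS]mxE; congr (_ * _); rewrite [LHS]mxE.
by apply: eq_bigr => l _; congr (_ * _); rewrite !mxE.
Qed.

Lemma measurable_invertible_rotation i j :
  measurable_fun setT (fun w => invertible_rotation w i j).
Proof.
rewrite (_ : (fun w => _) = fun w => if \det (rotation w) == 0
    then (1%:M : 'M[R]_K) i j else rotation w i j).
  apply: measurable_fun_ifT => //; last exact: measurable_rotation.
  apply: measurable_fun_eqr => //; apply: measurable_det; exact: measurable_rotation.
by apply/funext => w; rewrite /invertible_rotation; case: ifP.
Qed.

Definition rotation_RV i j : {RV (pPr m) >-> R} :=
  mfun_Sub (mem_set (measurable_invertible_rotation i j)).

Lemma rmx_rotation_RV w : rmx rotation_RV w = invertible_rotation w.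
Proof. by apply/matrixP => i j; rewrite mxE. Qed.

Lemma invertible_rotation_unit w : invertible_rotation w \in unitmx.
Proof.
rewrite /invertible_rotation; case: eqP => [_|/eqP d0]; first exact: unitmx1.
by rewrite unitmxE unitfE.
Qed.

Lemma invertible_rotationE w : rotation w \in unitmx ->
  invertible_rotation w = rotation w.
Proof. by rewrite unitmxE unitfE /invertible_rotation => /negbTE ->. Qed.

End RotationMatrix.

Theorem theorem4 (R : realType) (K k0 : nat) (gam C c : R)
  (m : forall N : nat, panel R K N)
  (Lhat : forall N : nat, nat -> 'I_N -> 'I_K -> {RV (pPr (m N)) >-> R})
  (Nn Tn : nat -> nat)
  (hk0 : (0 < k0)%N) (hgam : 2 < gam) (hc : 0 < c)
  (* zero means, and the model equation *)
  (hy0 : forall N, (K <= N)%N -> forall t i, ('E_(pPr (m N))[py (m N) t i] = 0)%E)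
  (hf0 : forall N, (K <= N)%N -> forall t j, ('E_(pPr (m N))[pf (m N) t j] = 0)%E)
  (hmodel : forall N, (K <= N)%N -> model_equation (m N))
  (* M has K non-zero eigenvalues, non-degenerate at its order N^2 *)
  (hM : forall N, (K <= N)%N ->
     nonzero_eigenvalues (Mmx (m N) k0) K (c * N%:R ^+ 2))
  (* the estimator *)
  (hLhat : forall N, (K <= N)%N -> forall T w,
     loading_estimate k0 T w (rmx (Lhat N T) w))
  (* (1) *)
  (hstat : forall N, (K <= N)%N -> strictly_stationary (m N))
  (hmix : forall N, (K <= N)%N ->
     (\sum_(1 <= k <oo) ((alpha (m N) k) `^ (1 - 2 / gam))%:E <= C%:E)%E)
  (* (2) *)
  (hW0 : forall N, (K <= N)%N -> forall i, pW (m N) i i = 0)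
  (hS : forall N, (K <= N)%N -> SN (m N) \in unitmx)
  (hWsum : forall N, (K <= N)%N -> abs_sums_le (pW (m N)) C)
  (hSsum : forall N, (K <= N)%N -> abs_sums_le (invmx (SN (m N))) C)
  (* (3) *)
  (hwn : forall N, (K <= N)%N -> white_noise (peps (m N)))
  (hyeps : forall N, (K <= N)%N -> forall (t : int) (j : nat), (1 <= j)%N ->
     Covmx (py (m N) (t - j%:Z)) (peps (m N) t) = 0)
  (hfeps : forall N, (K <= N)%N -> forall (t : int) (k : nat),
     Covmx (pf (m N) (t - k%:Z)) (peps (m N) t) = 0)
  (* (4) *)
  (hBrank : forall N, (K <= N)%N -> \rank (pB (m N)) = K)
  (hBnorm : forall N, (K <= N)%N ->
     N%:R^-1 *: ((pB (m N))^T *m invmx (SN (m N))^T *m invmx (SN (m N))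
                   *m pB (m N)) = 1%:M)
  (* (5) *)
  (hfmom : forall N, (K <= N)%N -> forall t j,
     ('E_(pPr (m N))[fun w => (`|pf (m N) t j w| `^ (2 * gam))%R] < C%:E)%E)
  (hemom : forall N, (K <= N)%N -> forall t i,
     ('E_(pPr (m N))[fun w => (`|peps (m N) t i w| `^ (2 * gam))%R] < C%:E)%E)
  (* (6) *)
  (hX : forall N, (K <= N)%N -> forall (i : 'I_N) (lam : R), 0 < lam ->
     \rank ((Xmx (m N) i)^T *m Xmx (m N) i + lam%:M)%R = K.+1)
  (* N, T tend to infinity with N = o(T) *)
  (hN : Nn @ \oo --> \oo) (hT : Tn @ \oo --> \oo)
  (hNT : (fun n => (Nn n)%:R / (Tn n)%:R : R) @ \oo --> (0 : R)) :
  exists H : forall N : nat, nat -> 'I_K -> 'I_K -> {RV (pPr (m N)) >-> R},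
    (forall N T w, rmx (H N T) w \in unitmx) /\
    bigO_p (fun n => pPr (m (Nn n)))
      (fun n w => (Num.sqrt (Nn n)%:R)^-1 *
         frob (rmx (Lhat (Nn n) (Tn n)) w
               - Lambda (m (Nn n)) *m (rmx (H (Nn n) (Tn n)) w)^T))
      (fun n => (Num.sqrt (Tn n)%:R)^-1).
Proof.
exists (fun N T => rotation_RV (Lhat N T)); split.
  by move=> N T w; rewrite rmx_rotation_RV invertible_rotation_unit.
move=> e e0.
pose wc := weight_constant K C.
pose B := \sum_(k < k0) autocov_constant C k.+1.
pose A := angle_constant K k0 C c.
have A0 : 0 <= A by exact: angle_constant_ge0.
(* Chosen so that Markov's inequality at the level u N^2, with u = del / T, gives a probability at
   most [e]; the absolute value and the added 1 secure [0 < del]. *)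
pose del := wc ^+ 2 * `|B| / e + 1.
have del0 : 0 < del.
  have q0 : 0 <= wc ^+ 2 * `|B| / e.
    by apply: divr_ge0; [rewrite mulr_ge0 ?sqr_ge0|exact: ltW].
  by rewrite /del ltr_wpDl.
(* On the good event the squared error is at most x / T with [x = A * del], and x < (1 + x)^2 gives
   the strict inequality needed below. *)
exists (1 + A * del); first by rewrite ltr_pwDl// mulr_ge0// ltW.
(* [del * (1 + A) <= T] yields both [u <= 1] and [A * u < 1], the latter for the invertibility of
   the rotation; [k0 <= T] lets every lag fit in the sample. *)
pose t0 := maxn (maxn 1 k0) (Num.truncn (del * (1 + A))).+1.
have nT : \forall n \near \oo, (t0 <= Tn n)%N by exact: (hT _ (nbhs_infty_ge t0)).
have nN : \forall n \near \oo, (maxn 1 K <= Nn n)%N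
  by exact: (hN _ (nbhs_infty_ge (maxn 1 K))).
near=> n.
have : (t0 <= Tn n)%N by near: n.
have : (maxn 1 K <= Nn n)%N by near: n.
rewrite /t0 !geq_max; move: (Nn n) (Tn n) => N T.
move=> /andP[N0 KN] /andP[/andP[T0 kT] tT].
have TR : del * (1 + A) <= T%:R.
  by rewrite (le_trans (ltW (truncnS_gt _)))// ler_nat.
have T0R : 0 < T%:R :> R by rewrite ltr0n.
have N0R : 0 < N%:R :> R by rewrite ltr0n.
pose u := del / T%:R.
have u1 : u <= 1.
  by rewrite ler_pdivrMr// mul1r (le_trans _ TR)// ler_peMr ?(ltW del0)// lerDl.
have Au1 : A * u < 1.
  by rewrite mulrA ltr_pdivrMr// mul1r (lt_le_trans _ TR)// mulrC ltr_pM2l// ltrDr.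
have eps0 t i : ('E_(pPr (m N))[peps (m N) t i] = 0)%E.
  by have [] := hwn _ KN.
have hmo := hmodel _ KN.
have iprod s t a b := integ_product hgam hmo (hfmom _ KN) (hemom _ KN) s t a b.
have Eprod s t a b := Ex_product_le hgam hmo (hfmom _ KN) (hemom _ KN) s t a b.
have [hSrow _] := hSsum _ KN.
have mse k a b : (k < k0)%N ->
    integ (pPr (m N)) (fun w => @autocov_error R K N (m N) k.+1 T a b w ^+ 2) /\
    Ex (pPr (m N)) (fun w => @autocov_error R K N (m N) k.+1 T a b w ^+ 2) <=
    autocov_constant C k.+1 / T%:R.
  move=> kk0; apply: (autocov_error_mean_square hgam hmo (hstat _ KN) (hmix _ KN)
    (hfmom _ KN) (hemom _ KN)) => //.
  exact: leq_trans kT.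
have [iTE ETE] := total_error_mean N0 hSrow (hBnorm _ KN) mse.
have bound w : total_error k0 T w < u * N%:R ^+ 2 ->
    (Num.sqrt N%:R)^-1 * frob (rmx (Lhat N T) w - Lambda (m N) *m
      (rmx (rotation_RV (Lhat N T)) w)^T) < (1 + A * del) * (Num.sqrt T%:R)^-1.
  move=> tew; have [Hu He] := loading_error_bound KN N0 hc hmo (hS _ KN) (hy0 _ KN) eps0
    (hyeps _ KN) iprod Eprod hSrow (hBnorm _ KN) (hM _ KN) (hLhat _ KN T w) u1 (ltW tew) Au1.
  rewrite rmx_rotation_RV invertible_rotationE//.
  rewrite -ltr_sqr ?nnegrE; last first.
  - by rewrite mulr_ge0 ?invr_ge0 ?sqrtr_ge0// addr_ge0// mulr_ge0// ltW.
  - by rewrite mulr_ge0 ?invr_ge0 ?sqrtr_ge0.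
  apply: (le_lt_trans He); rewrite exprMn exprVn sqr_sqrtr ?ltW//.
  rewrite /u mulrA ltr_pM2r ?invr_gt0//.
  have : 0 <= A * del by rewrite mulr_ge0// ltW.
  by rewrite -/A; move: (A * del) => x x0; nra.
pose X (w : pOm (m N)) := (Num.sqrt N%:R)^-1 * frob (rmx (Lhat N T) w -
  Lambda (m N) *m (rmx (rotation_RV (Lhat N T)) w)^T).
have X0 w : 0 <= X w by rewrite mulr_ge0 ?invr_ge0 ?sqrtr_ge0.
have mX : measurable_fun setT X.
  apply: measurable_funM => //; apply: measurable_frob => i j.
  rewrite (_ : (fun w => _) = fun w => Lhat N T i j w -
      \sum_l Lambda (m N) i l * rotation_RV (Lhat N T) j l w).
    apply: measurable_funB => //; apply: measurable_sum => l.
    exact: measurable_funM.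
  apply/funext => w; rewrite [LHS]mxE [X in X + _]mxE [X in _ + X]mxE [X in - X]mxE.
  by congr (_ - _); apply: eq_bigr => l _; congr (_ * _); rewrite !mxE.
have uN0 : 0 < u * N%:R ^+ 2 by rewrite mulr_gt0 ?divr_gt0 ?exprn_gt0.
have te0 w : 0 <= total_error k0 (m := m N) T w.
  by apply: sumr_ge0 => k _; exact: weighted_error_ge0.
have mkv := Markov_Ex iTE te0 uN0.
have mte : measurable [set w | u * N%:R ^+ 2 <= total_error k0 (m := m N) T w].
  exact: measurable_ge (integ_measurable iTE).
have mE : measurable [set w | (1 + A * del) * (Num.sqrt T%:R)^-1 < `|X w|].
  apply: measurable_gt; exact: measurableT_comp.
(* Where the total error is below its threshold, [bound] excludes a large loading error; this gives
   the inclusion of events, and [le_measure] also asks that both be measurable. *)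
apply: (@le_trans _ _ (pPr (m N) [set w | u * N%:R ^+ 2 <= total_error k0 T w])).
  apply: le_measure; [exact: mem_set|exact: mem_set|] => w /= aX.
  rewrite leNgt; apply/negP => /bound; rewrite -/(X w) => Xa.
  by rewrite (ger0_norm (X0 w)) in aX; have := lt_trans aX Xa; rewrite ltxx.
rewrite -(@fineK _ (pPr (m N) _)) ?fin_num_measure// lee_fin.
apply: (le_trans mkv); rewrite ler_pdivrMr//; apply: (le_trans ETE).
rewrite -mulr_suml -/B -/wc /u.
have -> : (N%:R * wc) ^+ 2 * (B / T%:R) = wc ^+ 2 * B / T%:R * N%:R ^+ 2 by ring.
have N2 : 0 < N%:R ^+ 2 :> R by rewrite exprn_gt0.
have Ti : 0 < T%:R^-1 :> R by rewrite invr_gt0.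
have -> : e * (del / T%:R * N%:R ^+ 2) = e * del / T%:R * N%:R ^+ 2 by ring.
rewrite (ler_pM2r N2) (ler_pM2r Ti).
apply: (@le_trans _ _ (wc ^+ 2 * `|B|)).
  by rewrite ler_wpM2l ?sqr_ge0// ler_norm.
by rewrite -ler_pdivrMl// mulrC /del lerDl.
Unshelve. all: by end_near.
Qed.
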